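(* Let $\mathsf G$ be a finite or countable connected graph, $Y\subset\ell^2(\mathsf E)$ a closed linear subspace, $P_Y$ the orthogonal projection of $\ell^2(\mathsf E)$ onto $Y$, and $P_{\mathcal Y}$ the orthogonal projection of $H$ onto $\mathcal Y$. The following assertions are equivalent. (a) The projection $P_{\mathcal Y}$ is admissible, i.e. $P_{\mathcal Y}V\subset V$. (b) The range of $\tilde{\mathcal I}$ is invariant under $\widehat{P_Y}$, i.e. $\begin{pmatrix}P_Y&0\\0&P_Y\end{pmatrix}\mathrm{Range}\,\tilde{\mathcal I}\subset\mathrm{Range}\,\tilde{\mathcal I}$. (c) There exists a basis of $\mathrm{Range}\,\tilde{\mathcal I}$ consisting of eigenvectors of $\widehat{P_Y}$.
   Context: $\mathsf G$ has vertex set $\mathsf V$ and edge set $\mathsf E$ (finite or countable); each edge $\mathsf e$ is parametrised by $[0,1]$ and has endpoints $\mathsf e(0),\mathsf e(1)\in\mathsf V$. $\mathsf G$ is connected if any two vertices are joined by a finite (undirected) path. The incidence matrices are $\iota^+_{\mathsf v\mathsf e}=1$ if $\mathsf e(0)=\mathsf v$ and $0$ otherwise, $\iota^-_{\mathsf v\mathsf e}=1$ if $\mathsf e(1)=\mathsf v$ and $0$ otherwise; $\mathcal I^\pm=(\iota^\pm_{\mathsf v\mathsf e})$. $H:=\bigoplus_{\mathsf e\in\mathsf E}L^2(0,1)$ (Hilbert space direct sum; $\psi(x)=(\psi_{\mathsf e}(x))_{\mathsf e}\in\ell^2(\mathsf E)$ for a.e. $x$) and $$V:=\Big\{\psi\in\bigoplus_{\mathsf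 e\in\mathsf E}H^1(0,1):\ \exists d^\psi\in\ell^2(\mathsf V),\ (\mathcal I^+)^\top d^\psi=\psi(0),\ (\mathcal I^-)^\top d^\psi=\psi(1)\Big\},$$ i.e. $\psi$ is continuous in the nodes. $\mathcal Y:=\{\psi\in H:\psi(x)\in Y\text{ for a.e. }x\in(0,1)\}$. $\tilde{\mathcal I}:=\begin{pmatrix}(\mathcal I^+)^\top\\(\mathcal I^-)^\top\end{pmatrix}$ is regarded as a (possibly unbounded) operator from $\ell^2(\mathsf V)$ to $\ell^2(\mathsf E)\times\ell^2(\mathsf E)$ with its maximal domain, and $\widehat{P_Y}:=\begin{pmatrix}P_Y&0\\0&P_Y\end{pmatrix}$ on $\ell^2(\mathsf E)\times\ell^2(\mathsf E)$. ''Basis'' in (c) is an algebraic (linear) basis. *)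

(* Defs.v *)
From HB Require Import structures.
From mathcomp Require Import all_boot all_order all_algebra finmap complex.
From mathcomp Require Import all_classical all_reals all_analysis.

Set Implicit Arguments.
Unset Strict Implicit.
Unset Printing Implicit Defensive.

Import Order.TTheory GRing.Theory Num.Theory.
Import numFieldNormedType.Exports.

Local Open Scope classical_set_scope.
Local Open Scope ring_scope.
Local Open Scope complex_scope.

(* A countType is a finite or countably infinite type. Loops and parallel
   edges are allowed. *)
Record graph := Graph {
  vertex : countType;
  edge : countType;
  edge_init : edge -> vertex;   (* e(0) *)
  edge_term : edge -> vertex }. (* e(1) *)

Definition adjacent (G : graph) (v w : vertex G) : Prop :=
  exists e : edge G, (edge_init e = v /\ edge_term e = w) \/ (edge_init e = w /\ edge_term e = v).

Definition connected_graph (G : graph) : Prop :=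
  forall v w : vertex G, exists p : seq (vertex G),
    path (fun x y => `[< adjacent x y >]) v p /\ last v p = w.

Section Summation.
Context {R : realType} {I : choiceType}.

(* Unconditional sums of families that are absolutely summable (the only ones
   to which they are applied): positive part minus negative part. *)
Definition rsum (f : I -> R) : R :=
  fine (\esum_(i in [set: I]) ((EFin \o f)^\+)%E i
        - \esum_(i in [set: I]) ((EFin \o f)^\-)%E i)%E.

Definition csum (f : I -> R[i]) : R[i] :=
  rsum (fun i => complex.Re (f i)) +i* rsum (fun i => complex.Im (f i)).

End Summation.

Definition sqmod {R : realType} (z : R[i]) : R := complex.Re z ^+ 2 + complex.Im z ^+ 2.

(* [ip] is the inner product. On a Hilbert space the set below is a singleton
   for every closed subspace [Y]; for spaces of functions that are only
   identified up to a null set, one representative is chosen. *)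
Definition orth_proj {R : realType} {X : lmodType R[i]}
    (ip : X -> X -> R[i]) (Y : set X) (x : X) : X :=
  xget 0 [set y | Y y /\ forall z, Y z -> ip (x - y) z = 0].

Section SequenceSpace.
Context {R : realType} {I : choiceType}.

Definition l2_sqnorm (x : I -> R[i]) : \bar R :=
  \esum_(i in [set: I]) (sqmod (x i))%:E.

Definition l2 : set (I -> R[i]) := [set x | (l2_sqnorm x < +oo)%E].

Definition l2_dot (x y : I -> R[i]) : R[i] := csum (fun i => x i * (y i)^*).

Definition l2_closed_subspace (Y : set (I -> R[i])) : Prop :=
  [/\ Y `<=` l2,
      Y 0,
      forall (a : R[i]) x y, Y x -> Y y -> Y (a *: x + y) &
      forall x, l2 x ->
        (forall eps : R, 0 < eps ->
           exists2 y, Y y & (l2_sqnorm (x - y)%R < eps%:E)%E) -> Y x].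

End SequenceSpace.
Arguments l2 : clear implicits.

Section UnitInterval.
Context {R : realType}.
Let mu := @lebesgue_measure R.

Definition cintegral (f : R -> R[i]) : R[i] :=
  (\int[mu]_(t in `]0, 1[) complex.Re (f t)) +i* (\int[mu]_(t in `]0, 1[) complex.Im (f t)).

Definition ae01 (P : R -> Prop) : Prop :=
  {ae mu, forall t, t \in `]0, 1[ -> P t}.

Definition cmeasurable (f : R -> R[i]) : Prop :=
  measurable_fun (`]0, 1[ : set R) (fun t => complex.Re (f t)) /\
  measurable_fun (`]0, 1[ : set R) (fun t => complex.Im (f t)).

Definition L2_sqnorm (f : R -> R[i]) : \bar R :=
  (\int[mu]_(t in `]0%R, 1%R[) (sqmod (f t))%:E)%E.

(* H^1(0,1) is defined by weak derivatives tested against C^1_c(0,1) (the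
   convention of Brezis' textbook). *)
Definition test_function (phi : R -> R) : Prop :=
  [/\ forall t, derivable phi t 1,
      continuous (phi^`())%classic &
      exists a b : R, [/\ 0 < a, b < 1 &
        forall t, t \notin `[a, b] -> phi t = 0]].

Definition weak_derivative (f g : R -> R[i]) : Prop :=
  forall phi, test_function phi ->
    cintegral (fun t => f t * (phi^`()%classic t)%:C) =
    - cintegral (fun t => g t * (phi t)%:C).

(* The continuous function on [0,1] that agrees a.e. with [f], which exists for
   [f] in H^1(0,1) and is unique on [0,1]; point values psi(0), psi(1) refer
   to it. *)
Definition continuous_rep (f : R -> R[i]) : R -> R[i] :=
  xget 0 [set v : R -> R[i] | [/\ {within `[0, 1], continuous (fun t : R => complex.Re (v t))},
                      {within `[0, 1], continuous (fun t : R => complex.Im (v t))} &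
                      ae01 (fun t => f t = v t)]].

End UnitInterval.

(* Elements of Lebesgue spaces are represented by functions; every subset below
   is closed under modification on a null set of (0,1) (and outside (0,1)). *)
Section DirectSum.
Context {R : realType} {I : choiceType}.

Definition L2_sum : set (I -> R -> R[i]) :=
  [set psi | (forall e, cmeasurable (psi e)) /\
             (\esum_(e in [set: I]) L2_sqnorm (psi e) < +oo)%E].

Definition L2_sum_dot (psi phi : I -> R -> R[i]) : R[i] :=
  csum (fun e => cintegral (fun t => psi e t * (phi e t)^*)).

(* The squared norm of the direct sum of the spaces H^1(0,1) is
   sum_e (|psi_e|^2 + |psi_e'|^2), with L^2 norms. *)
Definition H1_sum : set (I -> R -> R[i]) :=
  [set psi | L2_sum psi /\
     exists2 dpsi : I -> R -> R[i],
       L2_sum dpsi & forall e, weak_derivative (psi e) (dpsi e)].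

Definition boundary_value (psi : I -> R -> R[i]) (t : R) : I -> R[i] :=
  fun e => continuous_rep (psi e) t.

Definition calY (Y : set (I -> R[i])) : set (I -> R -> R[i]) :=
  [set psi | L2_sum psi /\ ae01 (fun t => Y (fun e => psi e t))].

End DirectSum.

Section Network.
Context {R : realType} (G : graph).
Local Notation V := (vertex G).
Local Notation E := (edge G).

Definition incidence_plus (v : V) (e : E) : R[i] := (edge_init e == v)%:R.
Definition incidence_minus (v : V) (e : E) : R[i] := (edge_term e == v)%:R.

(* Each column of an incidence matrix has a single nonzero entry, so the
   finitely supported sum is the full matrix-vector product. *)
Definition transpose_apply (M : V -> E -> R[i]) (d : V -> R[i]) : E -> R[i] :=
  fun e => \sum_(v \in [set: V]) M v e * d v.

Definition network_form_domain : set (E -> R -> R[i]) :=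
  [set psi | H1_sum psi /\
     exists d : V -> R[i],
       [/\ l2 R V d,
           transpose_apply incidence_plus d = boundary_value psi 0 &
           transpose_apply incidence_minus d = boundary_value psi 1]].

Definition tildeI (d : V -> R[i]) : (E -> R[i]) * (E -> R[i]) :=
  (transpose_apply incidence_plus d, transpose_apply incidence_minus d).

Definition tildeI_domain : set (V -> R[i]) :=
  [set d | l2 R V d /\ (l2 R E `*` l2 R E) (tildeI d)].

Definition tildeI_range : set ((E -> R[i]) * (E -> R[i])) :=
  tildeI @` tildeI_domain.

Definition P_Y (Y : set (E -> R[i])) : (E -> R[i]) -> (E -> R[i]) :=
  orth_proj l2_dot Y.

Definition hatP_Y (Y : set (E -> R[i])) (x : (E -> R[i]) * (E -> R[i])) :
    (E -> R[i]) * (E -> R[i]) :=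
  (P_Y Y x.1, P_Y Y x.2).

Definition P_calY (Y : set (E -> R[i])) :
    (E -> R -> R[i]) -> (E -> R -> R[i]) :=
  orth_proj L2_sum_dot (calY Y).

End Network.
Arguments network_form_domain : clear implicits.
Arguments tildeI_range : clear implicits.

Section LinearAlgebra.
Context {K : fieldType} {X : lmodType K}.

Definition linear_span (B : set X) : set X :=
  [set x | exists (F : {fset X}) (c : X -> K),
     [set` F] `<=` B /\ x = \sum_(b <- F) c b *: b].

Definition linearly_independent (B : set X) : Prop :=
  forall (F : {fset X}) (c : X -> K), [set` F] `<=` B ->
    \sum_(b <- F) c b *: b = 0 -> forall b, b \in F -> c b = 0.

Definition algebraic_basis (B W : set X) : Prop :=
  linearly_independent B /\ linear_span B = W.

Definition eigenvector (T : X -> X) (x : X) : Prop :=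
  x <> 0 /\ exists lambda : K, T x = lambda *: x.

End LinearAlgebra.

(* Main.v *)
Require Import Defs.
From HB Require Import structures.
From mathcomp Require Import all_boot all_order all_algebra finmap complex.
From mathcomp Require Import all_classical all_reals all_analysis.
From mathcomp Require Import measurable_realfun.
From mathcomp Require Import ring lra.

(** The projection onto [calY Y] acts fibrewise: almost everywhere, its value at
    [t] is the projection of [psi t] onto [Y]. This projection exists by the
    Hilbert projection theorem ([orth_proj_exists]), and each of its coordinates
    is an inner product with a fixed square-summable vector, so Fubini's theorem gives a single commutation rule,
    [cintegral_fibre_proj]: integrating a family against a bounded scalar
    function and then projecting is the same as projecting the family first.

    A function with a weak derivative is almost everywhere a primitive of that
    derivative ([weak_derivative_primitive]), so its values at 0 and 1 are
    integrals of the function and of the derivative against 1, [t] and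
    [1 - t] ([continuous_rep_boundary]). The commutation rule then shows at once
    that the projection of a function in $H^1$ has the projected derivative as
    weak derivative and the projected boundary values as boundary values
    ([boundary_value_fibre_proj]). Boundary values of functions in the form
    domain are exactly the elements of the range of the incidence operator, the
    affine functions on the edges realizing each of them. Hence the form domain
    is invariant if and only if this range is, which is the equivalence of the
    first two assertions ([admissible_iff_range_invariant]).

    The equivalence of the last two assertions is linear algebra: an idempotent
    that leaves a subspace invariant splits it into its fixed vectors and its
    kernel, and a spanning set of eigenvectors contains a basis
    ([invariant_iff_eigenbasis]). *)

Set Implicit Arguments.
Unset Strict Implicit.
Unset Printing Implicit Defensive.

Import Order.TTheory GRing.Theory Num.Theory.
Import numFieldNormedType.Exports.

Local Open Scope classical_set_scope.
Local Open Scope ring_scope.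
Local Open Scope complex_scope.

(** * Absolutely summable families *)

Section RealSums.
Context {R : realType} {I : choiceType}.
Implicit Types f g p q : I -> R.

Definition asummable f : Prop := (\esum_(i in [set: I]) `|f i|%:E < +oo)%E.

Lemma asummable_le f g : (forall i, `|f i| <= g i) -> asummable g -> asummable f.
Proof.
move=> fg; apply: le_lt_trans; apply: le_esum => i _.
by rewrite lee_fin (le_trans (fg i)) // ler_norm.
Qed.

Lemma asummableD f g : asummable f -> asummable g -> asummable (fun i => f i + g i).
Proof.
move=> sf sg; apply: (@le_lt_trans _ _
  (\esum_(i in [set: I]) (`|f i|%:E + `|g i|%:E))%E).
  by apply: le_esum => i _; rewrite -EFinD lee_fin ler_normD.
by rewrite esumD; [exact: lte_add_pinfty | move=> i _; rewrite lee_fin | move=> i _; rewrite lee_fin].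
Qed.

Lemma asummableN f : asummable f -> asummable (fun i => - f i).
Proof.
by move=> sf; apply: le_lt_trans sf; apply: le_esum => i _; rewrite normrN.
Qed.

Lemma esumZ (c : R) (a : I -> \bar R) : 0 <= c -> (forall i, 0 <= a i)%E ->
  (\esum_(i in [set: I]) (c%:E * a i) = c%:E * \esum_(i in [set: I]) a i)%E.
Proof.
move=> c0 a0; rewrite /esum -ereal_supZl//; last first.
  by apply/set0P; exists (\sum_(x \in set0) a x)%R; exists set0 => //; split.
congr ereal_sup; apply/seteqP; split.
  move=> _ /= [F FI <-]; exists (\sum_(x \in F) a x)%R; first by exists F.
  by rewrite ge0_mule_fsumr.
by move=> _ /= [_ [F FI <-] <-]; exists F => //; rewrite ge0_mule_fsumr.
Qed.

Lemma asummableZ (c : R) f : asummable f -> asummable (fun i => c * f i).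
Proof.
move=> sf; rewrite /asummable.
under eq_esum do rewrite normrM EFinM.
rewrite esumZ//.
exact: lte_mul_pinfty.
Qed.

Lemma asummable_fin f : asummable f -> (forall i, 0 <= f i) ->
  (\esum_(i in [set: I]) (f i)%:E)%E \is a fin_num.
Proof.
move=> sf f0; rewrite ge0_fin_numE; last by apply: esum_ge0 => i _; rewrite lee_fin.
by apply: le_lt_trans sf; apply: le_esum => i _; rewrite lee_fin ler_norm.
Qed.

(** [rsum] is defined through positive and negative parts, which do not add up;
    every other decomposition into nonnegative summable families gives the same
    value, and additivity and homogeneity follow from this freedom. *)
Lemma rsum_split f p q : (forall i, f i = p i - q i) ->
  (forall i, 0 <= p i) -> (forall i, 0 <= q i) -> asummable p -> asummable q ->
  rsum f = fine (\esum_(i in [set: I]) (p i)%:E) - fine (\esum_(i in [set: I]) (q i)%:E).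
Proof.
move=> fpq p0 q0 sp sq; rewrite /rsum -fineB ?asummable_fin//.
have -> : EFin \o f = ((EFin \o p) \- (EFin \o q))%E.
  by apply/funext => i /=; rewrite fpq EFinB.
by congr fine; apply: (@esumB R I setT (EFin \o p) (EFin \o q)) => // i _ /=; rewrite lee_fin.
Qed.

Lemma rsum_ge0E f : (forall i, 0 <= f i) -> asummable f ->
  rsum f = fine (\esum_(i in [set: I]) (f i)%:E).
Proof.
move=> f0 sf; rewrite (@rsum_split f f (fun=> 0)) ?subr0//.
- by rewrite [X in _ - fine X]esum1// subr0.
- by move=> i; rewrite subr0.
- by rewrite /asummable esum1// => i _; rewrite normr0.
Qed.

Lemma rsum_ge0 f : (forall i, 0 <= f i) -> asummable f -> 0 <= rsum f.
Proof.
move=> f0 sf; rewrite rsum_ge0E// fine_ge0// esum_ge0// => i _.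
by rewrite lee_fin.
Qed.

Let pos f i := Num.max (f i) 0.
Let neg f i := Num.max (- f i) 0.
Let posneg f i : f i = pos f i - neg f i.
Proof. by rewrite /pos /neg; case: (lerP (f i) 0); case: (lerP (- f i) 0); lra. Qed.
Let pos_ge0 f i : 0 <= pos f i. Proof. by rewrite /pos le_max lexx orbT. Qed.
Let neg_ge0 f i : 0 <= neg f i. Proof. by rewrite /neg le_max lexx orbT. Qed.
Let pos_sum f : asummable f -> asummable (pos f).
Proof.
move=> sf; apply: (@asummable_le _ (fun i => `|f i|)).
  by move=> i; rewrite ger0_norm// /pos ge_max normr_ge0 ler_norm.
by apply: le_lt_trans sf; apply: le_esum => i _; rewrite normr_id.
Qed.
Let neg_sum f : asummable f -> asummable (neg f).
Proof.
move=> sf; apply: (@asummable_le _ (fun i => `|f i|)).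
  by move=> i; rewrite ger0_norm// /neg ge_max normr_ge0 -normrN ler_norm.
by apply: le_lt_trans sf; apply: le_esum => i _; rewrite normr_id.
Qed.

Lemma rsum_posneg f : asummable f ->
  rsum f = fine (\esum_(i in [set: I]) (Num.max (f i) 0)%:E)
         - fine (\esum_(i in [set: I]) (Num.max (- f i) 0)%:E).
Proof. by move=> sf; apply: (@rsum_split f (pos f) (neg f)); auto. Qed.

Lemma rsumD f g : asummable f -> asummable g ->
  rsum (fun i => f i + g i) = rsum f + rsum g.
Proof.
move=> sf sg.
rewrite (@rsum_split _ (fun i => pos f i + pos g i) (fun i => neg f i + neg g i)).
- rewrite !rsum_posneg// -/(pos f) -/(pos g).
  under eq_esum do rewrite EFinD.
  rewrite [X in _ - fine X](_ : _ = \esum_(i in [set: I]) ((neg f i)%:E + (neg g i)%:E)%E); last first.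
    by apply: eq_esum => i _; rewrite EFinD.
  rewrite !esumD; try by move=> i _; rewrite lee_fin.
  rewrite !fineD ?asummable_fin//; auto.
  by rewrite /pos /neg; lra.
- by move=> i; rewrite (posneg f i) (posneg g i); lra.
- by move=> i; apply: addr_ge0.
- by move=> i; apply: addr_ge0.
- by apply: asummableD; auto.
- by apply: asummableD; auto.
Qed.

Lemma rsumN f : asummable f -> rsum (fun i => - f i) = - rsum f.
Proof.
move=> sf; rewrite (@rsum_split _ (neg f) (pos f)); auto.
  by rewrite (rsum_posneg sf) opprB.
by move=> i; rewrite (posneg f i) opprB.
Qed.

Lemma rsum0 : rsum (fun _ : I => 0) = 0 :> R.
Proof.
have s0 : asummable (fun=> 0) by rewrite /asummable esum1// => i _; rewrite normr0.
by rewrite rsum_ge0E// esum1.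
Qed.

Let rsumZ_ge0 (c : R) f : 0 <= c -> asummable f -> rsum (fun i => c * f i) = c * rsum f.
Proof.
move=> c0 sf.
rewrite (@rsum_split _ (fun i => c * pos f i) (fun i => c * neg f i)).
- under eq_esum do rewrite EFinM.
  rewrite [X in _ - fine X](_ : _ = \esum_(i in [set: I]) (c%:E * (neg f i)%:E)%E); last first.
    by apply: eq_esum => i _; rewrite EFinM.
  rewrite !esumZ//; try by move=> i; rewrite lee_fin.
  by rewrite !fineM ?asummable_fin//=; auto; rewrite -mulrBr -rsum_posneg.
- by move=> i; rewrite (posneg f i); lra.
- by move=> i; apply: mulr_ge0.
- by move=> i; apply: mulr_ge0.
- by apply: asummableZ; auto.
- by apply: asummableZ; auto.
Qed.

Lemma rsumZ (c : R) f : asummable f -> rsum (fun i => c * f i) = c * rsum f.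
Proof.
move=> sf; have [c0|/ltW c0] := leP 0 c; first exact: rsumZ_ge0.
rewrite -[c]opprK mulNr -rsumZ_ge0 ?oppr_ge0// -rsumN; last exact: asummableZ.
by congr rsum; apply/funext => i; rewrite mulNr.
Qed.

Lemma rsum_ge_fsum f (F : {fset I}) : (forall i, 0 <= f i) -> asummable f ->
  \sum_(i <- F) f i <= rsum f.
Proof.
move=> f0 sf; rewrite rsum_ge0E// -lee_fin fineK ?asummable_fin// -sumEFin.
apply: esum_ge; exists [set` F]; first by split => //; exact: finite_fset.
by rewrite fsbig_finite ?set_fsetK//=; exact: finite_fset.
Qed.

(** A supremum of finite sums is controlled by a bound on each of them.
    Coordinatewise limits pass through finite sums, so this is how limits are
    estimated below. *)
Lemma fsum_le_asummable f (M : R) : (forall i, 0 <= f i) ->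
  (forall F : {fset I}, \sum_(i <- F) f i <= M) ->
  asummable f /\ rsum f <= M.
Proof.
move=> f0 fM.
have le : (\esum_(i in [set: I]) (f i)%:E <= M%:E)%E.
  apply: ub_ereal_sup => _ [F [fF _] <-].
  by rewrite fsbig_finite//= sumEFin lee_fin.
have sf : asummable f.
  apply: le_lt_trans (ltry M); apply: le_trans le.
  by apply: le_esum => i _; rewrite ger0_norm.
by split => //; rewrite rsum_ge0E// -lee_fin fineK ?asummable_fin.
Qed.

Lemma rsum_single f j : (forall i, i != j -> f i = 0) -> asummable f /\ rsum f = f j.
Proof.
move=> fj.
have E (g : I -> R) : (forall i, i != j -> g i = 0) -> (forall i, 0 <= g i) ->
    (\esum_(i in [set: I]) (g i)%:E = (g j)%:E)%E.
  move=> gj g0; rewrite (esumID [set j])//; last by move=> i _; rewrite lee_fin.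
  rewrite setTI esum_set1 ?lee_fin// [X in (_ + X)%E]esum1 ?adde0// => i [_ /= ij].
  by rewrite gj//; apply/eqP.
have sf : asummable f.
  by rewrite /asummable E ?ltry// => i ij; rewrite fj// normr0.
split => //; rewrite rsum_posneg// !E/=.
- by case: (lerP (f j) 0); case: (lerP (- f j) 0); lra.
- by move=> i /fj ->; rewrite oppr0 maxxx.
- by move=> i; rewrite le_max lexx orbT.
- by move=> i /fj ->; rewrite maxxx.
- by move=> i; rewrite le_max lexx orbT.
Qed.

End RealSums.

(** * Complex-valued sums *)

Local Notation Re := complex.Re.
Local Notation Im := complex.Im.

Section ComplexParts.
Context {R : realType}.
Implicit Types z w : R[i].

Lemma ReM z w : Re (z * w) = Re z * Re w - Im z * Im w.
Proof. by case: z; case: w. Qed.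

Lemma ImM z w : Im (z * w) = Re z * Im w + Im z * Re w.
Proof. by case: z; case: w. Qed.

Lemma ReD z w : Re (z + w) = Re z + Re w.
Proof. by case: z; case: w. Qed.

Lemma ImD z w : Im (z + w) = Im z + Im w.
Proof. by case: z; case: w. Qed.

Lemma ReN z : Re (- z) = - Re z.
Proof. by case: z. Qed.

Lemma ImN z : Im (- z) = - Im z.
Proof. by case: z. Qed.

Lemma Reconj z : Re (z^*) = Re z.
Proof. by case: z. Qed.

Lemma Imconj z : Im (z^*) = - Im z.
Proof. by case: z. Qed.

Lemma ReC (a : R) : Re (a%:C) = a.
Proof. by []. Qed.

Lemma ImC (a : R) : Im (a%:C) = 0.
Proof. by []. Qed.

Definition reCE := (ReC, ImC).

Definition reimE := (ReM, ImM, ReD, ImD, ReN, ImN, Reconj, Imconj).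

Lemma sqmod_ge0 z : 0 <= sqmod z.
Proof. by rewrite addr_ge0 ?sqr_ge0. Qed.

Lemma sqmod_eq0 z : sqmod z = 0 -> z = 0.
Proof.
case: z => a b /eqP; rewrite /sqmod/= paddr_eq0 ?sqr_ge0// !sqrf_eq0.
by case/andP => /eqP -> /eqP ->.
Qed.

Lemma sqmodM z w : sqmod (z * w) = sqmod z * sqmod w.
Proof. by rewrite /sqmod !reimE; ring. Qed.

Lemma sqmodN z : sqmod (- z) = sqmod z.
Proof. by rewrite /sqmod !reimE; ring. Qed.

Lemma sqmodC (a : R) : sqmod a%:C = a ^+ 2.
Proof. by rewrite /sqmod/=; ring. Qed.

Lemma sqmodD_le z w : sqmod (z + w) <= 2 * sqmod z + 2 * sqmod w.
Proof.
rewrite /sqmod !reimE.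
have := sqr_ge0 (Re z - Re w); have := sqr_ge0 (Im z - Im w).
by rewrite !expr2; lra.
Qed.

Lemma normRe_conjM_le z w : `|Re (z * w^*)| <= sqmod z + sqmod w.
Proof.
rewrite /sqmod !reimE ler_norml.
have := sqr_ge0 (Re z - Re w); have := sqr_ge0 (Im z - Im w).
have := sqr_ge0 (Re z + Re w); have := sqr_ge0 (Im z + Im w).
by rewrite !expr2; move=> *; apply/andP; split; lra.
Qed.

Lemma normIm_conjM_le z w : `|Im (z * w^*)| <= sqmod z + sqmod w.
Proof.
rewrite /sqmod !reimE ler_norml.
have := sqr_ge0 (Re z - Im w); have := sqr_ge0 (Im z - Re w).
have := sqr_ge0 (Re z + Im w); have := sqr_ge0 (Im z + Re w).
by rewrite !expr2; move=> *; apply/andP; split; lra.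
Qed.

Lemma complex_eq z w : Re z = Re w -> Im z = Im w -> z = w.
Proof. by case: z => a b; case: w => c d /= -> ->. Qed.

(** This identity makes the inner product of a family with itself its squared
    norm. *)
Lemma mul_conj z : z * z^* = (sqmod z)%:C.
Proof. by apply: complex_eq; rewrite !reimE /sqmod/=; ring. Qed.

End ComplexParts.

Section ComplexSums.
Context {R : realType} {I : choiceType}.
Implicit Types f g : I -> R[i].

Definition casummable f : Prop :=
  asummable (fun i => Re (f i)) /\ asummable (fun i => Im (f i)).

Lemma Re_csum f : Re (csum f) = rsum (fun i => Re (f i)). Proof. by []. Qed.
Lemma Im_csum f : Im (csum f) = rsum (fun i => Im (f i)). Proof. by []. Qed.

Lemma csumD f g : casummable f -> casummable g ->
  csum (fun i => f i + g i) = csum f + csum g.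
Proof.
move=> [fr fi] [gr gi]; apply: complex_eq; rewrite !reimE !(Re_csum, Im_csum) -rsumD//.
  by congr rsum; apply/funext => i; rewrite reimE.
by congr rsum; apply/funext => i; rewrite reimE.
Qed.

Lemma csumZ (c : R[i]) f : casummable f -> csum (fun i => c * f i) = c * csum f.
Proof.
move=> [fr fi]; apply: complex_eq; rewrite !reimE !(Re_csum, Im_csum) -!rsumZ//.
  rewrite -rsumN; last exact: asummableZ.
  rewrite -rsumD; [|exact: asummableZ|by apply: asummableN; exact: asummableZ].
  by congr rsum; apply/funext => i; rewrite reimE.
rewrite -rsumD; [|exact: asummableZ|exact: asummableZ].
by congr rsum; apply/funext => i; rewrite reimE.
Qed.

Lemma csum_conj f : casummable f -> csum (fun i => (f i)^*) = (csum f)^*.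
Proof.
move=> [fr fi]; apply: complex_eq; rewrite !reimE !(Re_csum, Im_csum) -?rsumN//.
  by congr rsum; apply/funext => i; rewrite reimE.
by congr rsum; apply/funext => i; rewrite reimE.
Qed.

End ComplexSums.

(** * The Hilbert space of square-summable sequences *)

Section SquareSummable.
Context {R : realType} {I : choiceType}.
Implicit Types x y z : I -> R[i].

Definition nsq x : R := rsum (fun i => sqmod (x i)).

Lemma l2P x : l2 R I x <-> asummable (fun i => sqmod (x i)).
Proof.
rewrite /l2/= /l2_sqnorm /asummable.
by under [X in _ <-> (X < _)%E]eq_esum do rewrite ger0_norm ?sqmod_ge0//.
Qed.

Lemma l2_sqnormE x : l2 R I x -> l2_sqnorm x = (nsq x)%:E.
Proof.
move=> /l2P sx; rewrite /nsq rsum_ge0E//; last by move=> i; exact: sqmod_ge0.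
by rewrite fineK// asummable_fin// => i; exact: sqmod_ge0.
Qed.

Lemma nsq_ge0 x : l2 R I x -> 0 <= nsq x.
Proof. by move=> /l2P; apply: rsum_ge0 => i; exact: sqmod_ge0. Qed.

Lemma l2_0 : l2 R I 0.
Proof.
apply/l2P; rewrite /asummable esum1// => i _.
by rewrite /sqmod/= expr0n/= addr0 normr0.
Qed.

Lemma l2D x y : l2 R I x -> l2 R I y -> l2 R I (x + y).
Proof.
move=> /l2P lx /l2P ly; apply/l2P.
apply: (@asummable_le _ _ _ (fun i => 2 * sqmod (x i) + 2 * sqmod (y i))).
  by move=> i; rewrite ger0_norm ?sqmod_ge0// sqmodD_le.
by apply: asummableD; exact: asummableZ.
Qed.

Lemma l2Z (c : R[i]) x : l2 R I x -> l2 R I (c *: x).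
Proof.
move=> /l2P lx; apply/l2P.
have -> : (fun i => sqmod ((c *: x) i)) = (fun i => sqmod c * sqmod (x i)).
  by apply/funext => i; rewrite -sqmodM.
exact: asummableZ.
Qed.

Lemma l2N x : l2 R I x -> l2 R I (- x).
Proof. by move=> lx; rewrite -scaleN1r; exact: l2Z. Qed.

Lemma l2B x y : l2 R I x -> l2 R I y -> l2 R I (x - y).
Proof. by move=> lx ly; apply: l2D => //; exact: l2N. Qed.

Lemma l2_dot_asummable x y : l2 R I x -> l2 R I y ->
  casummable (fun i => x i * (y i)^*).
Proof.
move=> /l2P lx /l2P ly; have s := asummableD lx ly.
split; apply: asummable_le s => i; [exact: normRe_conjM_le|exact: normIm_conjM_le].
Qed.

Lemma l2_dotDl x y z : l2 R I x -> l2 R I y -> l2 R I z ->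
  l2_dot (x + y) z = l2_dot x z + l2_dot y z.
Proof.
move=> lx ly lz; rewrite /l2_dot -csumD; try exact: l2_dot_asummable.
by congr csum; apply/funext => i; rewrite -mulrDl.
Qed.

Lemma l2_dotZl (c : R[i]) x z : l2 R I x -> l2 R I z ->
  l2_dot (c *: x) z = c * l2_dot x z.
Proof.
move=> lx lz; rewrite /l2_dot -csumZ; last exact: l2_dot_asummable.
by congr csum; apply/funext => i; rewrite mulrA.
Qed.

Lemma l2_dotNl x z : l2 R I x -> l2 R I z -> l2_dot (- x) z = - l2_dot x z.
Proof. by move=> lx lz; rewrite -scaleN1r l2_dotZl// mulN1r. Qed.

Lemma l2_dotBl x y z : l2 R I x -> l2 R I y -> l2 R I z ->
  l2_dot (x - y) z = l2_dot x z - l2_dot y z.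
Proof. by move=> lx ly lz; rewrite l2_dotDl ?l2_dotNl//; exact: l2N. Qed.

Lemma l2_dotC x y : l2 R I x -> l2 R I y -> l2_dot y x = (l2_dot x y)^*.
Proof.
move=> lx ly; rewrite /l2_dot -csum_conj; last exact: l2_dot_asummable.
by congr csum; apply/funext => i; apply: complex_eq; rewrite !reimE; ring.
Qed.

Lemma l2_dotxx x : l2_dot x x = (nsq x)%:C.
Proof.
rewrite /l2_dot /nsq; under eq_fun do rewrite mul_conj.
by rewrite /csum/= rsum0.
Qed.

Lemma sqmod_le_nsq x j : l2 R I x -> sqmod (x j) <= nsq x.
Proof.
move=> /l2P lx.
have := rsum_ge_fsum [fset j]%fset (fun i => sqmod_ge0 (x i)) lx.
by rewrite big_seq_fset1.
Qed.

Lemma nsq_eq0 x : l2 R I x -> nsq x = 0 -> x = 0.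
Proof.
move=> lx x0; apply/funext => j; apply: sqmod_eq0; apply/le_anti.
by rewrite sqmod_ge0 andbT -x0 sqmod_le_nsq.
Qed.

Lemma nsqD x y : l2 R I x -> l2 R I y ->
  nsq (x + y) = nsq x + nsq y + 2 * Re (l2_dot x y).
Proof.
move=> lx ly; have lxy := l2D lx ly.
have : Re (l2_dot (x + y) (x + y)) = nsq (x + y) by rewrite l2_dotxx.
rewrite l2_dotDl// (l2_dotC lxy lx) (l2_dotC lxy ly) !l2_dotDl// !l2_dotxx (l2_dotC lx ly).
by move=> <-; rewrite !reimE/=; lra.
Qed.

Lemma nsqZ (c : R[i]) x : l2 R I x -> nsq (c *: x) = sqmod c * nsq x.
Proof.
move=> /l2P lx; rewrite /nsq -rsumZ//.
by congr rsum; apply/funext => i; rewrite -sqmodM.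
Qed.

Lemma nsqN x : nsq (- x) = nsq x.
Proof. by congr rsum; apply/funext => i; rewrite -sqmodN opprK. Qed.

Lemma parallelogram x y : l2 R I x -> l2 R I y ->
  nsq (x + y) + nsq (x - y) = 2 * nsq x + 2 * nsq y.
Proof.
move=> lx ly; rewrite !nsqD//; last exact: l2N.
rewrite nsqN (l2_dotC (l2N ly) lx) l2_dotNl// (l2_dotC lx ly).
by rewrite !reimE; lra.
Qed.

End SquareSummable.

(** * Orthogonal projection onto a closed subspace *)

Section Projection.
Context {R : realType} {I : choiceType}.
Implicit Types x y z : I -> R[i].

(** Fatou's lemma for the counting measure: squared norms are lower
    semicontinuous under coordinatewise limits, because each finite partial sum
    is continuous. The vanishing error [a] lets it be applied to minimizing
    sequences. *)
Lemma nsq_lim_le (w_ : nat -> I -> R[i]) (w : I -> R[i]) (M : R) (a : nat -> R) :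
  (forall i, Re (w_ m i) @[m --> \oo] --> Re (w i)) ->
  (forall i, Im (w_ m i) @[m --> \oo] --> Im (w i)) ->
  (forall m, l2 R I (w_ m)) -> (forall m, nsq (w_ m) <= M + a m) ->
  a m @[m --> \oo] --> 0 ->
  l2 R I w /\ nsq w <= M.
Proof.
move=> wr wi lw wM a0.
suff [sw le] : asummable (fun i => sqmod (w i)) /\ nsq w <= M by split => //; apply/l2P.
apply: fsum_le_asummable => [i|F]; first exact: sqmod_ge0.
have cF : (fun m => \sum_(i <- F) sqmod (w_ m i)) @ \oo --> \sum_(i <- F) sqmod (w i).
  apply: cvg_big => [|i _]; first exact: add_continuous.
  by rewrite /sqmod; apply: cvgD; rewrite !expr2; apply: cvgM; auto.
have cM : M + a m @[m --> \oo] --> M.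
  by rewrite -[X in _ --> X]addr0; apply: cvgD => //; exact: cvg_cst.
apply: (ler_cvg_to cF cM); apply: nearW => m.
apply: le_trans (wM m); apply: rsum_ge_fsum => [i|]; first exact: sqmod_ge0.
exact: (proj1 (l2P _) (lw m)).
Qed.

Lemma cauchy_real_cvg (u : nat -> R) (b : nat -> R) :
  (forall n m, (u n - u m) ^+ 2 <= b n + b m) -> b m @[m --> \oo] --> 0 ->
  cvg (u @ \oo).
Proof.
move=> ub b0; apply/cauchy_cvgP/cauchy_exP => e e0.
have e2 : 0 < e ^+ 2 / 2 by rewrite divr_gt0// exprn_gt0.
move/cvgrPdist_lt : b0 => /(_ _ e2)[N _ bN].
exists (u N); exists N => // m /= Nm; rewrite /ball/=.
rewrite -(@ltr_pXn2r _ 2)// ?nnegrE ?ltW// real_normK ?num_real//.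
apply: le_lt_trans (ub N m) _.
have := bN N (leqnn N); have := bN m Nm; rewrite /= !sub0r !normrN.
by have := ler_norm (b m); have := ler_norm (b N); lra.
Qed.

(** The Hilbert projection theorem. A sequence in [Y] minimizing the distance to
    [x] is Cauchy by the parallelogram law, since midpoints stay in [Y]. Its
    coordinatewise limit is also a limit in norm, hence lies in [Y], and it
    attains the distance; minimality in the direction of [z] then forces
    orthogonality to [z]. *)
Lemma orth_proj_exists (Y : set (I -> R[i])) x : l2_closed_subspace Y -> l2 R I x ->
  exists2 y, Y y & forall z, Y z -> l2_dot (x - y) z = 0.
Proof.
move=> [Yl2 Y0 Ylin Ycl] lx.
pose D := [set nsq (x - y) | y in Y].
have infD : has_inf D.
  split; first by exists (nsq (x - 0)), 0.
  by exists 0 => _ [y Yy <-]; apply: nsq_ge0; apply: l2B => //; exact: Yl2.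
pose delta := inf D.
have delta_le y : Y y -> delta <= nsq (x - y).
  by move=> Yy; apply: ge_inf; [case: infD | exists y].
pose a (n : nat) : R := n.+1%:R^-1.
have a_gt0 n : 0 < a n by rewrite invr_gt0 ltr0Sn.
have a0 : a n @[n --> \oo] --> 0 by exact: cvg_harmonic.
have a20 : 2 * a n @[n --> \oo] --> 0.
  by rewrite -[X in _ --> X](mulr0 2); apply: cvgM => //; exact: cvg_cst.
have /choice[y_ y_P] n : exists y, Y y /\ nsq (x - y) <= delta + a n.
  have [_ [y Yy <-] /ltW le] := inf_adherent (a_gt0 n) infD.
  by exists y.
have Yy_ n := (y_P n).1.
have ly_ n : l2 R I (y_ n) by apply: Yl2.
have yy n m : nsq (y_ n - y_ m) <= 2 * a n + 2 * a m.
  have lu := l2B lx (ly_ n); have lv := l2B lx (ly_ m).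
  have := parallelogram lv lu.
  have -> : x - y_ m - (x - y_ n) = y_ n - y_ m.
    by apply/funext => i; rewrite !fctE; ring.
  (* The midpoint, written with two nested combinations since closure of [Y] is
   stated for expressions of the form [a *: x + y]. *)
  have -> : x - y_ m + (x - y_ n) = 2 *: (x - (2^-1 *: (y_ m) + (2^-1 *: y_ n + 0))).
    by apply/funext => i; rewrite !fctE /GRing.scale/=; field.
  rewrite nsqZ.
    have := delta_le _ (Ylin 2^-1 _ _ (Yy_ m) (Ylin 2^-1 _ _ (Yy_ n) Y0)).
    have := (y_P n).2; have := (y_P m).2.
    have -> : sqmod (2 : R[i]) = 4 by rewrite /sqmod/=; lra.
    by lra.
  by apply: l2B => //; apply: Yl2; apply: (Ylin) => //; exact: Ylin.
have cre i : cvg (Re (y_ n i) @[n --> \oo]).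
  apply: (cauchy_real_cvg _ a20) => n m.
  apply: le_trans (yy n m).
  apply: le_trans (sqmod_le_nsq i (l2B (ly_ n) (ly_ m))).
  by rewrite /sqmod !fctE !reimE lerDl sqr_ge0.
have cim i : cvg (Im (y_ n i) @[n --> \oo]).
  apply: (cauchy_real_cvg _ a20) => n m.
  apply: le_trans (yy n m).
  apply: le_trans (sqmod_le_nsq i (l2B (ly_ n) (ly_ m))).
  by rewrite /sqmod !fctE !reimE lerDr sqr_ge0.
pose y i := (lim (Re (y_ n i) @[n --> \oo])) +i* (lim (Im (y_ n i) @[n --> \oo])).
have y_y n : l2 R I (y_ n - y) /\ nsq (y_ n - y) <= 2 * a n.
  apply: (@nsq_lim_le (fun m => y_ n - y_ m) _ _ (fun m => 2 * a m)) => //.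
  - move=> i; have -> : (fun m => Re ((y_ n - y_ m) i)) = (fun m => Re (y_ n i) - Re (y_ m i)).
      by apply/funext => m; rewrite !fctE !reimE.
    by rewrite !fctE !reimE; apply: cvgB; [exact: cvg_cst|exact: cre].
  - move=> i; have -> : (fun m => Im ((y_ n - y_ m) i)) = (fun m => Im (y_ n i) - Im (y_ m i)).
      by apply/funext => m; rewrite !fctE !reimE.
    by rewrite !fctE !reimE; apply: cvgB; [exact: cvg_cst|exact: cim].
  - by move=> m; exact: l2B.
have ly : l2 R I y.
  have -> : y = y_ 0%N - (y_ 0%N - y) by rewrite opprB addrC subrK.
  by apply: l2B => //; case: (y_y 0%N).
have Yy : Y y.
  apply: Ycl => // e e0.
  move/cvgrPdist_lt : a20 => /(_ _ e0)[N _ /(_ N (leqnn N))].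
  rewrite /= sub0r normrN => aN; exists (y_ N) => //.
  have [lN leN] := y_y N.
  have lyN : l2 R I (y - y_ N) by exact: l2B.
  rewrite l2_sqnormE// lte_fin -nsqN opprB.
  by apply: le_lt_trans leN _; apply: le_lt_trans aN; exact: ler_norm.
have xy : nsq (x - y) <= delta.
  apply: (proj2 (@nsq_lim_le (fun m => x - y_ m) _ _ a _ _ _ _ a0)) => //.
  - move=> i; have -> : (fun m => Re ((x - y_ m) i)) = (fun m => Re (x i) - Re (y_ m i)).
      by apply/funext => m; rewrite !fctE !reimE.
    by rewrite !fctE !reimE; apply: cvgB; [exact: cvg_cst|exact: cre].
  - move=> i; have -> : (fun m => Im ((x - y_ m) i)) = (fun m => Im (x i) - Im (y_ m i)).
      by apply/funext => m; rewrite !fctE !reimE.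
    by rewrite !fctE !reimE; apply: cvgB; [exact: cvg_cst|exact: cim].
  - by move=> m; exact: l2B.
  - by move=> m; case: (y_P m).
exists y => // z Yz.
have lz := Yl2 _ Yz; have lu := l2B lx ly; have N0 := nsq_ge0 lz.
set d := l2_dot (x - y) z; set N := nsq z in N0 *.
(* The perturbation of y along [t d z] lowers the squared distance at first
   order by [2 t |d|^2] and raises it by [t^2 |d|^2 N]; this t makes the loss dominate. *)
pose t : R := (N + 1)^-1.
have t0 : 0 < t by rewrite invr_gt0; lra.
have tN : t * N = 1 - t by rewrite /t; field; lra.
have lcz : l2 R I ((- (t%:C * d)) *: z) by exact: l2Z.
have := delta_le _ (Ylin (t%:C * d) _ _ Yz Yy).
have -> : x - (t%:C * d *: z + y) = (x - y) + (- (t%:C * d)) *: z.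
  by apply/funext => i; rewrite !fctE /GRing.scale/=; ring.
rewrite nsqD// nsqZ// sqmodN sqmodM sqmodC (l2_dotC lcz lu) l2_dotZl// (l2_dotC lu lz).
rewrite -/d -/N; clearbody d; rewrite !reimE !reCE !mul0r !subr0 !addr0 => le.
apply: sqmod_eq0; apply: le_anti; rewrite sqmod_ge0 andbT.
have {}le : 0 <= t * (t * N) * sqmod d - 2 * (t * sqmod d).
  by move: le xy; rewrite /sqmod; move: (Re d) (Im d) => p q; rewrite !expr2; lra.
move: le; rewrite tN.
have -> : t * (1 - t) * sqmod d - 2 * (t * sqmod d) = - (t * (1 + t) * sqmod d) by ring.
by rewrite oppr_ge0 pmulr_rle0// mulr_gt0//; lra.
Qed.

End Projection.

Section ProjectionTheory.
Context {R : realType} {I : choiceType}.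
Implicit Types x y z : I -> R[i].

Definition kronecker (j : I) : I -> R[i] := fun i => (i == j)%:R.

Lemma l2_kronecker j : l2 R I (kronecker j).
Proof.
apply/l2P; apply: (rsum_single (j := j) _).1 => i ij.
by rewrite /kronecker (negbTE ij) /sqmod/=; ring.
Qed.

Lemma l2_dot_kronecker x j : l2_dot x (kronecker j) = x j.
Proof.
have h (i : I) : i != j -> x i * (kronecker j i)^* = 0.
  by move=> ij; rewrite /kronecker (negbTE ij) rmorph0 mulr0.
apply: complex_eq.
  rewrite /l2_dot Re_csum (rsum_single (j := j) _).2 => [|i /h ->//].
  by rewrite /kronecker eqxx rmorph1 mulr1.
rewrite /l2_dot Im_csum (rsum_single (j := j) _).2 => [|i /h ->//].
by rewrite /kronecker eqxx rmorph1 mulr1.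
Qed.

Variable Y : set (I -> R[i]).
Hypothesis Ycl : l2_closed_subspace Y.
Let P := orth_proj l2_dot Y.

Lemma closed_subspace_l2 x : Y x -> l2 R I x.
Proof. by case: Ycl => + _ _ _; apply. Qed.
Let Yl2 := closed_subspace_l2.

Lemma closed_subspace0 : Y 0. Proof. by case: Ycl. Qed.

Lemma closed_subspaceB x y : Y x -> Y y -> Y (x - y).
Proof.
by case: Ycl => _ _ Ylin _ Yx Yy; have := Ylin (-1) _ _ Yy Yx; rewrite scaleN1r addrC.
Qed.

(** The value chosen by [xget] is not the default one, as a projection exists. *)
Lemma orth_projP x : l2 R I x -> Y (P x) /\ forall z, Y z -> l2_dot (x - P x) z = 0.
Proof.
move=> lx; have [y Yy yP] := orth_proj_exists Ycl lx.
exact: (@xgetI _ 0 [set y | Y y /\ forall z, Y z -> l2_dot (x - y) z = 0] y).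
Qed.

Lemma orth_proj_in x : l2 R I x -> Y (P x).
Proof. by move=> /orth_projP[]. Qed.

Lemma l2_orth_proj x : l2 R I x -> l2 R I (P x).
Proof. by move=> /orth_proj_in/Yl2. Qed.

Lemma orth_proj_unique x y : l2 R I x -> Y y ->
  (forall z, Y z -> l2_dot (x - y) z = 0) -> P x = y.
Proof.
move=> lx Yy yP; have [YP PP] := orth_projP lx.
have Yd : Y (P x - y) by exact: closed_subspaceB.
have ld := Yl2 Yd; have lP := Yl2 YP; have ly := Yl2 Yy.
apply/eqP; rewrite -subr_eq0; apply/eqP; apply: nsq_eq0 => //.
have : l2_dot (P x - y) (P x - y) = 0.
  have e : P x - y = (x - y) - (x - P x) by apply/funext => i; rewrite !fctE; ring.
  by rewrite [X in l2_dot X]e l2_dotBl ?yP ?PP ?subr0//; exact: l2B.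
by rewrite l2_dotxx => /(congr1 (@complex.Re R)).
Qed.

Lemma orth_proj_lin (a : R[i]) x y : l2 R I x -> l2 R I y ->
  P (a *: x + y) = a *: P x + P y.
Proof.
move=> lx ly; have [YP PP] := orth_projP lx; have [YQ QQ] := orth_projP ly.
have lax : l2 R I (a *: x) by exact: l2Z.
apply: orth_proj_unique; first exact: l2D.
  by case: Ycl => _ _ + _; apply.
move=> z Yz; have lz := Yl2 Yz.
have -> : a *: x + y - (a *: P x + P y) = a *: (x - P x) + (y - P y).
  by rewrite scalerBr opprD addrACA.
rewrite l2_dotDl//; [|by apply: l2Z; apply: l2B => //; exact: Yl2|by apply: l2B => //; exact: Yl2].
by rewrite l2_dotZl//; [rewrite PP// QQ// mulr0 addr0|apply: l2B => //; exact: Yl2].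
Qed.

Lemma orth_proj0 : P 0 = 0.
Proof.
have l0 : l2 R I 0 := Yl2 closed_subspace0.
by have := orth_proj_lin (-1) l0 l0; rewrite scaler0 addr0 scaleN1r addNr.
Qed.

Lemma orth_projD x y : l2 R I x -> l2 R I y -> P (x + y) = P x + P y.
Proof. by move=> lx ly; rewrite -[x in LHS]scale1r orth_proj_lin// scale1r. Qed.

Lemma orth_projZ (a : R[i]) x : l2 R I x -> P (a *: x) = a *: P x.
Proof.
move=> lx; have := orth_proj_lin a lx (Yl2 closed_subspace0).
by rewrite addr0 orth_proj0 addr0.
Qed.

Lemma orth_projN x : l2 R I x -> P (- x) = - P x.
Proof.
by move=> lx; have := orth_projZ (-1) lx; rewrite !scaleN1r.
Qed.

Lemma orth_projB x y : l2 R I x -> l2 R I y -> P (x - y) = P x - P y.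
Proof. by move=> lx ly; rewrite orth_projD ?orth_projN//; exact: l2N. Qed.

Lemma orth_proj_id x : Y x -> P x = x.
Proof.
move=> Yx; apply: orth_proj_unique => // [|z Yz]; first exact: Yl2.
have l0 : l2 R I 0 := Yl2 closed_subspace0.
by rewrite subrr -(scale0r 0) l2_dotZl ?mul0r//; exact: Yl2.
Qed.

(** Self-adjointness applied to a unit vector. Each coordinate of the projection
    is thus an inner product with a fixed vector, that is, a countable sum; this
    is what makes fibrewise projections measurable and lets them commute with
    integrals. *)
Lemma orth_proj_coord x j : l2 R I x -> P x j = l2_dot x (P (kronecker j)).
Proof.
move=> lx; have [YP PP] := orth_projP lx; have lk := l2_kronecker j.
have [YQ QQ] := orth_projP lk; have lP := Yl2 YP; have lQ := Yl2 YQ.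
have -> : l2_dot x (P (kronecker j)) = l2_dot (P x) (P (kronecker j)).
  by apply/eqP; rewrite -subr_eq0 -l2_dotBl// PP.
rewrite (l2_dotC lQ lP) -(l2_dot_kronecker (P x) j) (l2_dotC lk lP); congr (_^*).
by apply/eqP; rewrite -subr_eq0 -l2_dotBl// QQ.
Qed.

Lemma nsq_orth_proj x : l2 R I x -> nsq (P x) <= nsq x.
Proof.
move=> lx; have [YP PP] := orth_projP lx; have lP := Yl2 YP.
have lB : l2 R I (x - P x) by exact: l2B.
have -> : nsq x = nsq (x - P x + P x) by rewrite subrK.
by rewrite nsqD// PP// mulr0 addr0 lerDr nsq_ge0.
Qed.

End ProjectionTheory.

(** * Exchanging countable sums with integrals over the unit interval *)

Section TonelliFubini.
Context {R : realType} {I : countType}.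
Let mu := @lebesgue_measure R.
Local Notation J := (`]0%R, 1%R[%classic : set (measurableTypeR R)).

Let mJ : measurable J. Proof. exact: measurable_itv. Qed.

(** Unordered sums over a countable type become series over [nat] along the
    encoding [pickle], so that monotone convergence applies to them. *)
Lemma esum_nneseries (a : I -> \bar R) : (forall i, 0 <= a i)%E ->
  (\esum_(i in [set: I]) a i = \sum_(n <oo) oapp a 0 (choice.pickle_inv n))%E.
Proof.
move=> a0; set b := fun n => oapp a 0%E (choice.pickle_inv n).
have b0 n : (0 <= b n)%E by rewrite /b; case: (choice.pickle_inv n).
rewrite nneseries_esumT// -/b.
have -> : (\esum_(n in [set: nat]) b n = \esum_(n in range (@choice.pickle I)) b n)%E.
  rewrite [RHS]esum_mkcond; apply: eq_esum => n _; case: ifPn => // /negP nr.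
  rewrite /b; case: choice.pickle_inv (@pickle_invK I n) => //= i ni.
  by case: nr; rewrite inE; exists i.
rewrite (@reindex_esum R _ _ setT (range (@choice.pickle I)) (@choice.pickle I)).
  by apply: eq_esum => i _; rewrite /b pickleK_inv.
by split => // i j _ _; exact: (pcan_inj choice.pickleK).
Qed.

Lemma measurable_esum (F : I -> R -> \bar R) :
  (forall i, measurable_fun J (F i)) -> (forall i t, 0 <= F i t)%E ->
  measurable_fun J (fun t => \esum_(i in [set: I]) F i t)%E.
Proof.
move=> mF F0.
rewrite (_ : (fun t => _) = fun t => (\sum_(n <oo) oapp (F^~ t) 0 (choice.pickle_inv n))%E); last first.
  by apply/funext => t; rewrite esum_nneseries.
apply: (@ge0_emeasurable_sum _ _ _ _ (fun n t => oapp (F^~ t) 0%E (choice.pickle_inv n)) xpredT).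
  by move=> n t _ _; case: (choice.pickle_inv n) => /=.
move=> n _; case: (choice.pickle_inv n) => [i|]; first exact: mF.
exact: measurable_cst.
Qed.

(** Tonelli's theorem with the counting measure on one side. *)
Lemma integral_esum (F : I -> R -> \bar R) :
  (forall i, measurable_fun J (F i)) -> (forall i t, 0 <= F i t)%E ->
  (\int[mu]_(t in J) (\esum_(i in [set: I]) F i t) =
   \esum_(i in [set: I]) \int[mu]_(t in J) F i t)%E.
Proof.
move=> mF F0; rewrite esum_nneseries; last by move=> i; exact: integral_ge0.
rewrite (_ : (fun t => _) = fun t => (\sum_(n <oo) oapp (F^~ t) 0 (choice.pickle_inv n))%E); last first.
  by apply/funext => t; rewrite esum_nneseries.
rewrite integral_nneseries//.
- apply: eq_eseriesr => n _.
  by case: (choice.pickle_inv n) => //=; rewrite integral0.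
- move=> n; case: (choice.pickle_inv n) => [i|]; first exact: mF.
  exact: measurable_cst.
- by move=> n t _; case: (choice.pickle_inv n) => /=.
Qed.

Variables (F G : I -> R -> R).
Hypothesis mF : forall i, measurable_fun J (F i).
Hypothesis mG : forall i, measurable_fun J (G i).
Hypothesis FG : forall i t, `|F i t| <= G i t.
Hypothesis Gfin : (\esum_(i in [set: I]) \int[mu]_(t in J) (G i t)%:E < +oo)%E.

Let G0 i t : 0 <= G i t. Proof. exact: le_trans (FG i t). Qed.

Let mGE i : measurable_fun J (EFin \o G i).
Proof. exact/measurable_EFinP. Qed.

Let intG : mu.-integrable J (fun t => \esum_(i in [set: I]) (G i t)%:E)%E.
Proof.
apply/integrableP; split.
  by apply: (@measurable_esum (fun i => EFin \o G i)) => // i t; rewrite lee_fin.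
under eq_integral => t _.
  rewrite gee0_abs; last by apply: esum_ge0 => i _; rewrite lee_fin.
  over.
by rewrite (@integral_esum (fun i => EFin \o G i)).
Qed.

Let p i t := Num.max (F i t) 0.
Let q i t := Num.max (- F i t) 0.
Let A t := (\esum_(i in [set: I]) (p i t)%:E)%E.
Let B t := (\esum_(i in [set: I]) (q i t)%:E)%E.
Let p0 i t : 0 <= p i t. Proof. by rewrite /p le_max lexx orbT. Qed.
Let q0 i t : 0 <= q i t. Proof. by rewrite /q le_max lexx orbT. Qed.
Let pG i t : p i t <= G i t.
Proof. by rewrite /p ge_max G0 andbT (le_trans _ (FG i t))// ler_norm. Qed.
Let qG i t : q i t <= G i t.
Proof. by rewrite /q ge_max G0 andbT (le_trans _ (FG i t))// -normrN ler_norm. Qed.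
Let mp i : measurable_fun J (p i).
Proof. by apply: measurable_maxr => //; exact: measurable_cst. Qed.
Let mq i : measurable_fun J (q i).
Proof.
by apply: measurable_maxr; [exact: measurableT_comp | exact: measurable_cst].
Qed.
Let mpE i : measurable_fun J (EFin \o p i). Proof. exact/measurable_EFinP. Qed.
Let mqE i : measurable_fun J (EFin \o q i). Proof. exact/measurable_EFinP. Qed.

Let AE t : (\esum_(i in [set: I]) (EFin \o F^~ t)^\+ i)%E = A t.
Proof. by apply: eq_esum => i _; rewrite funeposE /= EFin_max. Qed.
Let BE t : (\esum_(i in [set: I]) (EFin \o F^~ t)^\- i)%E = B t.
Proof. by apply: eq_esum => i _; rewrite funenegE /= EFin_max EFinN. Qed.

Let mA : measurable_fun J A.
Proof. by apply: (@measurable_esum (fun i => EFin \o p i)) => // i t; rewrite lee_fin. Qed.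
Let mB : measurable_fun J B.
Proof. by apply: (@measurable_esum (fun i => EFin \o q i)) => // i t; rewrite lee_fin. Qed.
Let A0 t : (0 <= A t)%E. Proof. by apply: esum_ge0 => i _; rewrite lee_fin. Qed.
Let B0 t : (0 <= B t)%E. Proof. by apply: esum_ge0 => i _; rewrite lee_fin. Qed.

Let intA : mu.-integrable J A.
Proof.
apply: (le_integrable mJ mA _ intG) => t _.
rewrite !gee0_abs//; first by apply: le_esum => i _; rewrite lee_fin.
by apply: esum_ge0 => i _; rewrite lee_fin.
Qed.
Let intB : mu.-integrable J B.
Proof.
apply: (le_integrable mJ mB _ intG) => t _.
rewrite !gee0_abs//; first by apply: le_esum => i _; rewrite lee_fin.
by apply: esum_ge0 => i _; rewrite lee_fin.
Qed.

Let rsumE t : rsum (F^~ t) = fine (A t - B t)%E.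
Proof. by rewrite -AE -BE. Qed.

Lemma measurable_rsum : measurable_fun J (fun t => rsum (F^~ t)).
Proof.
rewrite (_ : (fun t => _) = fine \o (A \- B)%E); last by apply/funext => t; rewrite rsumE.
by apply: measurableT_comp => //; exact: emeasurable_funB.
Qed.

Let measurable_rsumE : measurable_fun J (EFin \o (fun t => rsum (F^~ t))).
Proof. by apply/measurable_EFinP; exact: measurable_rsum. Qed.

Let rsum_AB : ae_eq mu J (fun t => (rsum (F^~ t))%:E) (A \- B)%E.
Proof.
have := integrable_ae mJ intA; have := integrable_ae mJ intB.
apply: filterS2 => t fA fB Jt.
by rewrite rsumE fineK// fin_numB fA// fB.
Qed.

Lemma integrable_rsum : mu.-integrable J (EFin \o (fun t => rsum (F^~ t))).
Proof.
have intAB := integrableD mJ intA intB.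
apply: (le_integrable mJ measurable_rsumE _ intAB).
move=> t _; rewrite /= [X in (_ <= X)%E]gee0_abs ?adde_ge0// rsumE.
have := A0 t; have := B0 t; move: (A t) (B t) => [a| |] [b| |] //= b0 a0.
- rewrite -EFinD lee_fin; rewrite !lee_fin in a0 b0.
  by rewrite (le_trans (ler_normB _ _))// !ger0_norm.
- by rewrite normr0 leey.
- by rewrite normr0 leey.
- by rewrite normr0 leey.
Qed.

Let intF (f : R -> R) i : measurable_fun J f -> (forall t, `|f t| <= G i t) ->
  mu.-integrable J (EFin \o f) /\ `|\int[mu]_(t in J) f t| <= \int[mu]_(t in J) G i t.
Proof.
move=> mf fG.
have iG : mu.-integrable J (EFin \o G i).
  apply/integrableP; split => //; under eq_integral do rewrite gee0_abs ?lee_fin//.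
  apply: le_lt_trans Gfin; apply: esum_ge; exists [set i]; first by split => //; exact: finite_set1.
  by rewrite fsbig_set1.
have i_f : mu.-integrable J (EFin \o f).
  apply: (le_integrable mJ _ _ iG); first exact/measurable_EFinP.
  by move=> t _; rewrite /= lee_fin (ger0_norm (G0 i t)).
split => //; apply: le_trans (le_normr_Rintegral mJ i_f) _.
apply: le_Rintegral => //; exact: (integrable_norm i_f).
Qed.

Let asummable_int (f : I -> R -> R) :
  (forall i, measurable_fun J (f i)) -> (forall i t, `|f i t| <= G i t) ->
  asummable (fun i => \int[mu]_(t in J) f i t).
Proof.
move=> mf fG; apply: (@asummable_le _ _ _ (fun i => \int[mu]_(t in J) G i t)).
  by move=> i; case: (intF (mf i) (fG i)).
apply: le_lt_trans Gfin; apply: le_esum => i _.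
rewrite ger0_norm ?Rintegral_ge0// /Rintegral fineK//.
apply: integrable_fin_num => //.
by have [] := @intF (G i) i (mG i) (fun t => eq_ind_r (fun x => x <= _) (lexx _) (ger0_norm (G0 i t))).
Qed.

Lemma asummable_integral : asummable (fun i => \int[mu]_(t in J) F i t).
Proof. exact: asummable_int. Qed.

(** Fubini's theorem for a family dominated by [G], obtained from Tonelli's theorem
    for the positive and the negative parts. *)
Lemma integral_rsum :
  \int[mu]_(t in J) rsum (F^~ t) = rsum (fun i => \int[mu]_(t in J) F i t).
Proof.
have fpG i t : `|p i t| <= G i t by rewrite ger0_norm.
have fqG i t : `|q i t| <= G i t by rewrite ger0_norm.
rewrite {1}/Rintegral (@ae_eq_integral _ _ _ mu J (A \- B)%E)//; last exact: emeasurable_funB.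
rewrite integralB// /A /B.
rewrite (@integral_esum (fun i => EFin \o p i))//.
rewrite (@integral_esum (fun i => EFin \o q i))//.
rewrite (@rsum_split _ _ _ (fun i => \int[mu]_(t in J) p i t) (fun i => \int[mu]_(t in J) q i t)).
- have sp := asummable_int mp fpG; have sq := asummable_int mq fqG.
  have E (f : I -> R -> R) : (forall i, measurable_fun J (f i)) ->
      (forall i t, `|f i t| <= G i t) ->
      (\esum_(i in [set: I]) (\int[mu]_(t in J) f i t)%:E =
       \esum_(i in [set: I]) \int[mu]_(t in J) (f i t)%:E)%E.
    move=> mf fG; apply: eq_esum => i _; rewrite /Rintegral fineK//.
    by apply: integrable_fin_num => //; case: (intF (mf i) (fG i)).
  rewrite -fineB; last 2 first.
  - by rewrite asummable_fin// => i; exact: Rintegral_ge0.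
  - by rewrite asummable_fin// => i; exact: Rintegral_ge0.
  by rewrite !E.
- move=> i; have [ip _] := intF (mp i) (fpG i); have [iq _] := intF (mq i) (fqG i).
  rewrite -RintegralB//; apply: eq_Rintegral => t _.
  by rewrite /p /q; case: (lerP (F i t) 0); case: (lerP (- F i t) 0); lra.
- by move=> i; exact: Rintegral_ge0.
- by move=> i; exact: Rintegral_ge0.
- exact: asummable_int.
- exact: asummable_int.
Qed.

End TonelliFubini.

(** * Square-integrable families of functions on the unit interval *)

Section ComplexIntegral.
Context {R : realType}.
Let mu := @lebesgue_measure R.
Local Notation J := (`]0%R, 1%R[%classic : set (measurableTypeR R)).
Implicit Types f g : R -> R[i].

Lemma measurable_unit : measurable J. Proof. exact: measurable_itv. Qed.
Let mJ := measurable_unit.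

Let ae_filter : Filter (almost_everywhere (@lebesgue_measure R)).
Proof. exact: ae_filter_ringOfSetsType. Qed.

Lemma ae01S (P Q : R -> Prop) : (forall t, t \in `]0, 1[ -> P t -> Q t) ->
  ae01 P -> ae01 Q.
Proof.
by move=> PQ; apply: (@filterS _ _ ae_filter) => t Pt Jt; exact: PQ (Pt Jt).
Qed.

Lemma ae01_and (P Q : R -> Prop) : ae01 P -> ae01 Q -> ae01 (fun t => P t /\ Q t).
Proof.
by apply: (@filterS2 _ _ ae_filter) => t Pt Qt Jt; split; auto.
Qed.

Lemma ae01W (P : R -> Prop) : {ae @lebesgue_measure R, forall t, P t} -> ae01 P.
Proof. by apply: (@filterS _ _ ae_filter). Qed.

Lemma ae01_all (P : R -> Prop) : (forall t, t \in `]0, 1[ -> P t) -> ae01 P.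
Proof. by move=> PT; exact: aeW. Qed.

Definition cintegrable f : Prop :=
  mu.-integrable J (EFin \o (fun t => Re (f t))) /\
  mu.-integrable J (EFin \o (fun t => Im (f t))).

Lemma cmeasurable_cst (c : R[i]) : cmeasurable (fun=> c).
Proof. by split; exact: measurable_cst. Qed.

Let eq_measurable (h k : R -> R) : h =1 k -> measurable_fun J k -> measurable_fun J h.
Proof. by move=> /funext ->. Qed.

Lemma cmeasurableD f g : cmeasurable f -> cmeasurable g ->
  cmeasurable (fun t => f t + g t).
Proof.
move=> [fr fi] [gr gi]; split.
  by apply: (eq_measurable (fun t => ReD _ _)); exact: measurable_funD.
by apply: (eq_measurable (fun t => ImD _ _)); exact: measurable_funD.
Qed.

Lemma cmeasurableM f g : cmeasurable f -> cmeasurable g ->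
  cmeasurable (fun t => f t * g t).
Proof.
move=> [fr fi] [gr gi]; split.
  by apply: (eq_measurable (fun t => ReM _ _)); apply: measurable_funB; exact: measurable_funM.
by apply: (eq_measurable (fun t => ImM _ _)); apply: measurable_funD; exact: measurable_funM.
Qed.

Lemma cmeasurable_conj f : cmeasurable f -> cmeasurable (fun t => (f t)^*).
Proof.
move=> [fr fi]; split.
  exact: (eq_measurable (fun t => Reconj _)).
by apply: (eq_measurable (fun t => Imconj _)); exact: measurableT_comp.
Qed.

Lemma cmeasurableC (h : R -> R) : measurable_fun J h -> cmeasurable (fun t => (h t)%:C).
Proof. by move=> mh; split => //; exact: measurable_cst. Qed.

Lemma measurable_sqmod f : cmeasurable f -> measurable_fun J (fun t => sqmod (f t)).
Proof.
by move=> [fr fi]; apply: measurable_funD; apply: measurable_funX.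
Qed.

Lemma cintegrable_dom f (g : R -> R) : cmeasurable f -> mu.-integrable J (EFin \o g) ->
  (forall t, `|Re (f t)| <= g t) -> (forall t, `|Im (f t)| <= g t) -> cintegrable f.
Proof.
move=> [fr fi] ig rg ig'; split.
  apply: (le_integrable mJ _ _ ig); first exact/measurable_EFinP.
  by move=> t _; rewrite /= lee_fin (le_trans (rg t))// ler_norm.
apply: (le_integrable mJ _ _ ig); first exact/measurable_EFinP.
by move=> t _; rewrite /= lee_fin (le_trans (ig' t))// ler_norm.
Qed.

Lemma cintegrable_measurable f : cintegrable f -> cmeasurable f.
Proof.
by move=> [/integrableP[/measurable_EFinP fr _] /integrableP[/measurable_EFinP fi _]].
Qed.

Lemma cintegralD f g : cintegrable f -> cintegrable g ->
  cintegral (fun t => f t + g t) = cintegral f + cintegral g.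
Proof.
move=> [fr fi] [gr gi]; rewrite /cintegral; apply: complex_eq; rewrite !reimE /=.
  by rewrite -RintegralD//; apply: eq_Rintegral => t _; rewrite reimE.
by rewrite -RintegralD//; apply: eq_Rintegral => t _; rewrite reimE.
Qed.

Lemma integrableZ (h : R -> R) (c : R) : mu.-integrable J (EFin \o h) ->
  mu.-integrable J (EFin \o (fun t => c * h t)).
Proof.
move=> ih; have := integrableZl mJ c ih; apply: eq_integrable => // t _.
Qed.

Lemma cintegrableZ (c : R[i]) f : cintegrable f -> cintegrable (fun t => c * f t).
Proof.
move=> [fr fi]; split.
  have := integrableB mJ (integrableZ (Re c) fr) (integrableZ (Im c) fi).
  by apply: eq_integrable => // t _; rewrite /= reimE.
have := integrableD mJ (integrableZ (Re c) fi) (integrableZ (Im c) fr).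
by apply: eq_integrable => // t _; rewrite /= reimE.
Qed.

Lemma cintegralZ (c : R[i]) f : cintegrable f ->
  cintegral (fun t => c * f t) = c * cintegral f.
Proof.
move=> [fr fi]; rewrite /cintegral; apply: complex_eq; rewrite !reimE /=.
  rewrite -!RintegralZl// -RintegralB//; [|exact: integrableZ|exact: integrableZ].
  by apply: eq_Rintegral => t _; rewrite reimE.
rewrite -!RintegralZl// -RintegralD//; [|exact: integrableZ|exact: integrableZ].
by apply: eq_Rintegral => t _; rewrite reimE.
Qed.

Lemma cintegral_ae f g : cmeasurable f -> cmeasurable g ->
  ae01 (fun t => f t = g t) -> cintegral f = cintegral g.
Proof.
move=> [fr fi] [gr gi] fg; rewrite /cintegral /Rintegral; congr (_ +i* _).
  congr fine; apply: ae_eq_integral => //; [exact/measurable_EFinP|exact/measurable_EFinP|].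
  by move: fg; apply: (@filterS _ _ ae_filter) => t h /h ->.
congr fine; apply: ae_eq_integral => //; [exact/measurable_EFinP|exact/measurable_EFinP|].
by move: fg; apply: (@filterS _ _ ae_filter) => t h /h ->.
Qed.

Lemma eq_cintegral f g : (forall t, t \in `]0, 1[ -> f t = g t) -> cintegral f = cintegral g.
Proof.
move=> fg; rewrite /cintegral; congr (_ +i* _); apply: eq_Rintegral => t;
  by rewrite inE => /fg ->.
Qed.

End ComplexIntegral.

Section ComplexFubini.
Context {R : realType} {I : countType}.
Let mu := @lebesgue_measure R.
Local Notation J := (`]0%R, 1%R[%classic : set (measurableTypeR R)).
Variables (F : I -> R -> R[i]) (G : I -> R -> R).
Hypothesis mF : forall i, cmeasurable (F i).
Hypothesis mG : forall i, measurable_fun J (G i).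
Hypothesis rFG : forall i t, `|Re (F i t)| <= G i t.
Hypothesis iFG : forall i t, `|Im (F i t)| <= G i t.
Hypothesis Gfin : (\esum_(i in [set: I]) \int[mu]_(t in J) (G i t)%:E < +oo)%E.
Let Fr i t := Re (F i t).
Let Fi i t := Im (F i t).
Let mr i : measurable_fun J (Fr i). Proof. exact: (mF i).1. Qed.
Let mi i : measurable_fun J (Fi i). Proof. exact: (mF i).2. Qed.

Lemma casummable_cintegral : casummable (fun i => cintegral (F i)).
Proof.
split; first exact: (asummable_integral mr mG rFG Gfin).
exact: (asummable_integral mi mG iFG Gfin).
Qed.

Lemma cintegrable_csum : cintegrable (fun t => csum (F^~ t)).
Proof.
split; first exact: (integrable_rsum mr mG rFG Gfin).
exact: (integrable_rsum mi mG iFG Gfin).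
Qed.

Lemma cintegral_csum : cintegral (fun t => csum (F^~ t)) = csum (fun i => cintegral (F i)).
Proof.
apply: complex_eq; first exact: (integral_rsum mr mG rFG Gfin).
exact: (integral_rsum mi mG iFG Gfin).
Qed.

End ComplexFubini.

Section SquareIntegrable.
Context {R : realType} {I : countType}.
Let mu := @lebesgue_measure R.
Local Notation J := (`]0%R, 1%R[%classic : set (measurableTypeR R)).
Let mJ := @measurable_unit R.
Implicit Types (psi phi : I -> R -> R[i]) (u v : R -> R[i]) (h : R -> R).

Definition square_integrable u : Prop := cmeasurable u /\ (L2_sqnorm u < +oo)%E.

Lemma L2_sum_square psi e : L2_sum psi -> square_integrable (psi e).
Proof.
move=> [mpsi fin]; split => //; apply: le_lt_trans fin.
apply: esum_ge; exists [set e]; first by split => //; exact: finite_set1.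
by rewrite fsbig_set1.
Qed.

Lemma integrable_sqmod u : square_integrable u ->
  mu.-integrable J (EFin \o (fun t => sqmod (u t))).
Proof.
move=> [mu_ fin]; apply/integrableP; split.
  by apply/measurable_EFinP; exact: measurable_sqmod.
by under eq_integral do rewrite gee0_abs ?lee_fin ?sqmod_ge0//.
Qed.

Lemma square_integrable_mul_conj u v : square_integrable u -> square_integrable v ->
  cintegrable (fun t => u t * (v t)^*).
Proof.
move=> su sv.
apply: (@cintegrable_dom _ _ (fun t => sqmod (u t) + sqmod (v t))).
- by apply: cmeasurableM; [case: su | apply: cmeasurable_conj; case: sv].
- exact: (integrableD mJ (integrable_sqmod su) (integrable_sqmod sv)).
- by move=> t; exact: normRe_conjM_le.
- by move=> t; exact: normIm_conjM_le.
Qed.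

Lemma L2_sqnormD u v : cmeasurable u -> cmeasurable v ->
  (L2_sqnorm (fun t => u t + v t)%R <= 2%:E * L2_sqnorm u + 2%:E * L2_sqnorm v)%E.
Proof.
move=> mu_ mv; rewrite /L2_sqnorm.
have mEu := proj2 (measurable_EFinP _ _) (measurable_sqmod mu_).
have mEv := proj2 (measurable_EFinP _ _) (measurable_sqmod mv).
rewrite -!ge0_integralZl_EFin//; try by move=> t _; rewrite lee_fin sqmod_ge0.
rewrite -ge0_integralD//; try by move=> t _; rewrite ?mule_ge0// lee_fin sqmod_ge0.
apply: ge0_le_integral => //.
- by move=> t _; rewrite lee_fin sqmod_ge0.
- by apply/measurable_EFinP; apply: measurable_sqmod; exact: cmeasurableD.
- by apply: emeasurable_funD; exact: measurable_funeM.
- by move=> t _; rewrite -!EFinM -EFinD lee_fin sqmodD_le.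
- exact: measurable_funeM.
- exact: measurable_funeM.
Qed.

Lemma L2_sumD psi phi : L2_sum psi -> L2_sum phi -> L2_sum (psi + phi).
Proof.
move=> [mpsi fpsi] [mphi fphi]; split; first by move=> e; exact: cmeasurableD.
have L0 (u : R -> R[i]) : (0 <= L2_sqnorm u)%E.
  by apply: integral_ge0 => t _; rewrite lee_fin sqmod_ge0.
apply: (@le_lt_trans _ _ (\esum_(e in [set: I])
  (2%:E * L2_sqnorm (psi e) + 2%:E * L2_sqnorm (phi e)))%E).
  by apply: le_esum => e _; exact: L2_sqnormD.
rewrite esumD; try by move=> e _; rewrite mule_ge0.
by rewrite !esumZ//; apply: lte_add_pinfty; exact: lte_mul_pinfty.
Qed.

Lemma L2_sumM psi u (C : R) : L2_sum psi -> cmeasurable u ->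
  (forall t, t \in `]0, 1[ -> sqmod (u t) <= C) ->
  L2_sum (fun e t => u t * psi e t).
Proof.
move=> [mpsi fpsi] mu_ uC; split; first by move=> e; exact: cmeasurableM.
have L0 (v : R -> R[i]) : (0 <= L2_sqnorm v)%E.
  by apply: integral_ge0 => t _; rewrite lee_fin sqmod_ge0.
have C0 : 0 <= C.
  (* Any point of the open interval shows that the bound is nonnegative. *)
  apply: (le_trans (sqmod_ge0 (u 2^-1))); apply: uC.
  by rewrite in_itv/=; apply/andP; split; lra.
apply: (@le_lt_trans _ _ (\esum_(e in [set: I]) (C%:E * L2_sqnorm (psi e)))%E).
  apply: le_esum => e _.
  have mE := proj2 (measurable_EFinP _ _) (measurable_sqmod (mpsi e)).
  rewrite /L2_sqnorm -ge0_integralZl_EFin//; last by move=> t _; rewrite lee_fin sqmod_ge0.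
  apply: ge0_le_integral => //.
  - by move=> t _; rewrite lee_fin sqmod_ge0.
  - by apply/measurable_EFinP; apply: measurable_sqmod; exact: cmeasurableM.
  - exact: measurable_funeM.
  - by move=> t /uC ut; rewrite -EFinM lee_fin sqmodM ler_wpM2r// sqmod_ge0.
by rewrite esumZ//; exact: lte_mul_pinfty.
Qed.

Lemma L2_sumZ (a : R[i]) psi : L2_sum psi -> L2_sum (a *: psi).
Proof. by move=> lpsi; apply: (L2_sumM lpsi (cmeasurable_cst a)). Qed.

Lemma L2_sumN psi : L2_sum psi -> L2_sum (- psi).
Proof. by move=> lpsi; rewrite -scaleN1r; exact: L2_sumZ. Qed.

Lemma L2_sumB psi phi : L2_sum psi -> L2_sum phi -> L2_sum (psi - phi).
Proof. by move=> lpsi lphi; exact: L2_sumD lpsi (L2_sumN lphi). Qed.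

Lemma integral_unit_cst (c : \bar R) : (\int[mu]_(t in J) c = c)%E.
Proof.
have e : mu J = 1%E.
  by rewrite /mu (@lebesgue_measure_itv R `]0, 1[)/= lte_fin ltr01 oppr0 adde0.
by rewrite integral_cst// [X in (_ * X)%E]e mule1.
Qed.

Lemma L2_sum_cst (x : I -> R[i]) : l2 R I x -> L2_sum (fun e (_ : R) => x e).
Proof.
move=> lx; split; first by move=> e; exact: cmeasurable_cst.
apply: le_lt_trans lx; apply: le_esum => e _.
by rewrite /L2_sqnorm integral_unit_cst.
Qed.

(** Tonelli's theorem identifies the direct sum of the spaces $L^2(0,1)$ with the
    square-integrable functions with values in $\ell^2$. *)
Lemma L2_sum_section psi : (forall e, cmeasurable (psi e)) ->
  (\esum_(e in [set: I]) L2_sqnorm (psi e) =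
   \int[mu]_(t in J) l2_sqnorm (psi^~ t))%E.
Proof.
move=> mpsi; rewrite -(@integral_esum _ _ (fun e t => (sqmod (psi e t))%:E))//.
  by move=> e; apply/measurable_EFinP; exact: measurable_sqmod.
by move=> e t; rewrite lee_fin sqmod_ge0.
Qed.

Lemma measurable_l2_sqnorm psi : (forall e, cmeasurable (psi e)) ->
  measurable_fun J (fun t => l2_sqnorm (psi^~ t)).
Proof.
move=> mpsi; apply: (@measurable_esum _ _ (fun e t => (sqmod (psi e t))%:E)).
  by move=> e; apply/measurable_EFinP; exact: measurable_sqmod.
by move=> e t; rewrite lee_fin sqmod_ge0.
Qed.

Lemma L2_sum_ae_l2 psi : L2_sum psi -> ae01 (fun t => l2 R I (psi^~ t)).
Proof.
move=> [mpsi fpsi].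
have ge0 t : (0 <= l2_sqnorm (psi^~ t))%E.
  by apply: esum_ge0 => e _; rewrite lee_fin sqmod_ge0.
have : mu.-integrable J (fun t => l2_sqnorm (psi^~ t)).
  apply/integrableP; split; first exact: measurable_l2_sqnorm.
  under eq_integral do rewrite gee0_abs//.
  by rewrite -L2_sum_section.
move=> /(integrable_ae mJ) fin; apply: (ae01S _ (fin : ae01 _)) => t _ {}fin.
by rewrite /l2/= -ge0_fin_numE.
Qed.

Section Pairing.
Variables psi phi : I -> R -> R[i].
Hypothesis (lpsi : L2_sum psi) (lphi : L2_sum phi).
Let F e t := psi e t * (phi e t)^*.
Let G e t := sqmod (psi e t) + sqmod (phi e t).
Let mF e : cmeasurable (F e).
Proof. by apply: cmeasurableM; [exact: lpsi.1|apply: cmeasurable_conj; exact: lphi.1]. Qed.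
Let mG e : measurable_fun J (G e).
Proof. by apply: measurable_funD; apply: measurable_sqmod; [exact: lpsi.1|exact: lphi.1]. Qed.
Let rFG e t : `|Re (F e t)| <= G e t. Proof. exact: normRe_conjM_le. Qed.
Let iFG e t : `|Im (F e t)| <= G e t. Proof. exact: normIm_conjM_le. Qed.
Let Gfin : (\esum_(e in [set: I]) \int[mu]_(t in J) (G e t)%:E < +oo)%E.
Proof.
have E e : (\int[mu]_(t in J) (G e t)%:E = L2_sqnorm (psi e) + L2_sqnorm (phi e))%E.
  rewrite /L2_sqnorm -ge0_integralD//.
  - by move=> t _; rewrite lee_fin sqmod_ge0.
  - by apply/measurable_EFinP; apply: measurable_sqmod; exact: lpsi.1.
  - by move=> t _; rewrite lee_fin sqmod_ge0.
  - by apply/measurable_EFinP; apply: measurable_sqmod; exact: lphi.1.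
rewrite (eq_esum (fun e _ => E e)) esumD.
- by apply: lte_add_pinfty; [exact: lpsi.2|exact: lphi.2].
- by move=> e _; apply: integral_ge0 => t _; rewrite lee_fin sqmod_ge0.
- by move=> e _; apply: integral_ge0 => t _; rewrite lee_fin sqmod_ge0.
Qed.

Lemma L2_sum_dot_casummable : casummable (fun e => cintegral (F e)).
Proof. exact: (casummable_cintegral mF mG rFG iFG Gfin). Qed.

Lemma cintegrable_l2_dot : cintegrable (fun t => l2_dot (psi^~ t) (phi^~ t)).
Proof. exact: (cintegrable_csum mF mG rFG iFG Gfin). Qed.

(** The inner product of the direct sum is computed fibrewise; consequently
    orthogonality may be checked at almost every point. *)
Lemma L2_sum_dotE :
  L2_sum_dot psi phi = cintegral (fun t => l2_dot (psi^~ t) (phi^~ t)).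
Proof. by rewrite (cintegral_csum mF mG rFG iFG Gfin). Qed.

End Pairing.

Lemma L2_sum_dotDl psi psi' phi : L2_sum psi -> L2_sum psi' -> L2_sum phi ->
  L2_sum_dot (psi + psi') phi = L2_sum_dot psi phi + L2_sum_dot psi' phi.
Proof.
move=> l1 l2 l3; rewrite /L2_sum_dot -csumD; try exact: L2_sum_dot_casummable.
congr csum; apply/funext => e; rewrite -cintegralD; last 2 first.
- by apply: square_integrable_mul_conj; exact: L2_sum_square.
- by apply: square_integrable_mul_conj; exact: L2_sum_square.
by apply: eq_cintegral => t _; rewrite -mulrDl.
Qed.

(** The pairing is definite up to null sets. Elements of the direct sum are
    functions and not classes, so two orthogonal projections of the same family
    agree almost everywhere only. *)
Lemma L2_sum_dot_self0 psi : L2_sum psi -> L2_sum_dot psi psi = 0 ->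
  forall e, ae01 (fun t => psi e t = 0).
Proof.
move=> lpsi /(congr1 (@complex.Re R)) d0 e.
have sq := L2_sum_square e lpsi.
have E e' : Re (cintegral (fun t => psi e' t * (psi e' t)^*)) =
    \int[mu]_(t in J) sqmod (psi e' t).
  by rewrite /cintegral/=; apply: eq_Rintegral => t _; rewrite mul_conj.
have i0 e' : 0 <= \int[mu]_(t in J) sqmod (psi e' t).
  by apply: Rintegral_ge0 => t _; exact: sqmod_ge0.
have : \int[mu]_(t in J) sqmod (psi e t) <= 0.
  rewrite -[leRHS]d0 Re_csum; have [+ _] := L2_sum_dot_casummable lpsi lpsi.
  rewrite (_ : (fun e => Re _) = fun e => \int[mu]_(t in J) sqmod (psi e t)); last first.
    by apply/funext => e'; rewrite E.
  move=> /(rsum_ge_fsum [fset e]%fset i0).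
  by rewrite big_seq_fset1.
move=> le0; have int0 : (\int[mu]_(t in J) (sqmod (psi e t))%:E = 0)%E.
  have fin := integrable_fin_num mJ (integrable_sqmod sq).
  rewrite -(fineK fin); congr EFin; apply/le_anti; rewrite le0/=.
  exact: i0.
have : (\int[mu]_(t in J) `|(sqmod (psi e t))%:E| = 0)%E.
  by under eq_integral do rewrite gee0_abs ?lee_fin ?sqmod_ge0//.
move/(ae_eq_integral_abs _ mJ).
have me : measurable_fun J (fun t => (sqmod (psi e t))%:E).
  by apply/measurable_EFinP; apply: measurable_sqmod; case: sq.
move=> /(_ me) z; apply: (ae01S _ (z : ae01 _)) => t _ [].
exact: sqmod_eq0.
Qed.

End SquareIntegrable.

(** * Projecting square-integrable families fibrewise *)

Section Fibrewise.
Context {R : realType} {I : countType}.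
Let mu := @lebesgue_measure R.
Local Notation J := (`]0%R, 1%R[%classic : set (measurableTypeR R)).
Let mJ := @measurable_unit R.
Implicit Types (psi phi : I -> R -> R[i]) (u v : R -> R[i]) (h : R -> R).

Lemma square_integrable_cst (c : R[i]) : square_integrable (fun=> c).
Proof.
split; first exact: cmeasurable_cst.
by rewrite /L2_sqnorm integral_unit_cst ltry.
Qed.

Lemma square_integrable_cintegrable u : square_integrable u -> cintegrable u.
Proof.
move=> su; have := square_integrable_mul_conj su (square_integrable_cst 1).
by under eq_fun do rewrite rmorph1 mulr1.
Qed.

Lemma cintegral_cst (c : R[i]) : cintegral (fun=> c) = c.
Proof.
by apply: complex_eq; rewrite /cintegral/= /Rintegral integral_unit_cst.
Qed.

(** The Cauchy-Schwarz inequality on a probability space: the variance of [u] is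
    nonnegative. *)
Lemma sqmod_cintegral_le u : square_integrable u ->
  ((sqmod (cintegral u))%:E <= L2_sqnorm u)%E.
Proof.
move=> su; have iu := square_integrable_cintegrable su.
set m := cintegral u.
have isq := integrable_sqmod su.
have ifin := integrable_fin_num mJ isq.
rewrite /L2_sqnorm -(fineK ifin) lee_fin.
have E : \int[mu]_(t in J) sqmod (u t - m) = \int[mu]_(t in J) sqmod (u t) - sqmod m.
  have icm := cintegrableZ (m^*) iu.
  have ic1 : mu.-integrable J (EFin \o (fun=> sqmod m)).
    by have [] := square_integrable_cintegrable (square_integrable_cst (sqmod m)%:C).
  have ic2 := integrableZ 2 icm.1.
  transitivity (\int[mu]_(t in J) (sqmod (u t) - 2 * Re (m^* * u t) + sqmod m)).
    by apply: eq_Rintegral => t _; rewrite /sqmod !reimE; ring.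
  rewrite RintegralD//; last exact: (integrableB mJ isq ic2).
  rewrite RintegralB// RintegralZl//; last exact: icm.1.
  have -> : \int[mu]_(t in J) sqmod m = sqmod m by rewrite /Rintegral integral_unit_cst.
  have -> : \int[mu]_(t in J) Re (m^* * u t) = sqmod m.
    rewrite -[LHS]/(Re (cintegral (fun t => m^* * u t))) cintegralZ// -/m mulrC.
    by rewrite mul_conj.
  by ring.
have : 0 <= \int[mu]_(t in J) sqmod (u t - m).
  by apply: Rintegral_ge0 => t _; exact: sqmod_ge0.
by rewrite E subr_ge0.
Qed.

Lemma l2_cintegral psi : L2_sum psi -> l2 R I (fun e => cintegral (psi e)).
Proof.
move=> lpsi; apply: le_lt_trans lpsi.2; apply: le_esum => e _.
by apply: sqmod_cintegral_le; exact: L2_sum_square.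
Qed.

Lemma cintegral_l2_dot psi (p : I -> R[i]) : L2_sum psi -> l2 R I p ->
  cintegral (fun t => l2_dot (psi^~ t) p) = l2_dot (fun e => cintegral (psi e)) p.
Proof.
move=> lpsi lp; rewrite -(L2_sum_dotE lpsi (L2_sum_cst lp)).
congr csum; apply/funext => e; rewrite mulrC -cintegralZ.
  by apply: eq_cintegral => t _; rewrite mulrC.
by apply: square_integrable_cintegrable; exact: L2_sum_square.
Qed.

Variable Y : set (I -> R[i]).
Hypothesis Ycl : l2_closed_subspace Y.
Let P := orth_proj l2_dot Y.

(** The orthogonal projection applied at each point, written through its
    coordinates: at a point where the fibre is not square-summable the formula
    still makes sense and gives a measurable function. *)
Definition fibre_proj psi : I -> R -> R[i] :=
  fun e t => l2_dot (psi^~ t) (P (kronecker e)).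

Let lp e : l2 R I (P (kronecker e)).
Proof. exact: (l2_orth_proj Ycl (l2_kronecker e)). Qed.

Lemma fibre_projE psi t : l2 R I (psi^~ t) -> (fibre_proj psi)^~ t = P (psi^~ t).
Proof. by move=> lt; apply/funext => e; rewrite /P orth_proj_coord. Qed.

Lemma cmeasurable_fibre_proj psi e : L2_sum psi -> cmeasurable (fibre_proj psi e).
Proof.
move=> lpsi; apply: cintegrable_measurable.
exact: (cintegrable_l2_dot lpsi (L2_sum_cst (lp e))).
Qed.

(** The projection is a contraction at almost every point, and where the fibre is
    not square-summable the bound is infinite. *)
Lemma L2_sum_fibre_proj psi : L2_sum psi -> L2_sum (fibre_proj psi).
Proof.
move=> lpsi; have mQ e := cmeasurable_fibre_proj e lpsi.
split => //; rewrite L2_sum_section//; apply: le_lt_trans lpsi.2.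
rewrite [leRHS]L2_sum_section; last exact: lpsi.1.
have ge0 phi t : (0 <= l2_sqnorm (phi^~ t))%E.
  by apply: esum_ge0 => e _; rewrite lee_fin sqmod_ge0.
apply: ge0_le_integral => //.
- exact: measurable_l2_sqnorm.
- by apply: measurable_l2_sqnorm; exact: lpsi.1.
move=> t _; have [lt|nlt] := pselect (l2 R I (psi^~ t)).
  rewrite fibre_projE// !l2_sqnormE//; first by rewrite lee_fin; exact: (nsq_orth_proj Ycl).
  exact: (l2_orth_proj Ycl).
have -> : l2_sqnorm (psi^~ t) = +oo%E; last exact: leey.
by apply/eqP; rewrite -leye_eq leNgt; apply/negP.
Qed.

Lemma calY_fibre_proj psi : L2_sum psi -> calY Y (fibre_proj psi).
Proof.
move=> lpsi; split; first exact: L2_sum_fibre_proj.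
apply: ae01S (L2_sum_ae_l2 lpsi) => t _ lt.
by rewrite -[X in Y X]/((fibre_proj psi)^~ t) fibre_projE//; exact: (orth_proj_in Ycl).
Qed.

Lemma fibre_proj_orth psi phi : L2_sum psi -> calY Y phi ->
  L2_sum_dot (psi - fibre_proj psi) phi = 0.
Proof.
move=> lpsi [lphi Yphi]; have lQ := L2_sum_fibre_proj lpsi.
have lB := L2_sumB lpsi lQ.
rewrite (L2_sum_dotE lB lphi) -(cintegral_cst 0); apply: cintegral_ae.
- by apply: cintegrable_measurable; exact: cintegrable_l2_dot.
- exact: cmeasurable_cst.
apply: ae01S (ae01_and (L2_sum_ae_l2 lpsi) Yphi) => t _ [lt Yt].
have -> : (fun e => (psi - fibre_proj psi) e t) = psi^~ t - P (psi^~ t).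
  by rewrite -fibre_projE.
exact: (orth_projP Ycl lt).2.
Qed.

(** The fibrewise projection has the two defining properties of the orthogonal
    projection onto [calY Y], and such a function is unique up to null sets. *)
Lemma orth_proj_calY psi : L2_sum psi ->
  calY Y (orth_proj L2_sum_dot (calY Y) psi) /\
  forall e, ae01 (fun t => orth_proj L2_sum_dot (calY Y) psi e t = fibre_proj psi e t).
Proof.
move=> lpsi; set phi := orth_proj _ _ _; set Q := fibre_proj psi.
have YQ := calY_fibre_proj lpsi.
have [Yphi phiP] : calY Y phi /\ forall z, calY Y z -> L2_sum_dot (psi - phi) z = 0.
  apply: (@xgetI _ 0 [set y | calY Y y /\ forall z, calY Y z ->
    L2_sum_dot (psi - y) z = 0] Q).
  by split => // z Yz; exact: fibre_proj_orth.
split => // e.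
have Yd : calY Y (phi - Q).
  split; first exact: (L2_sumB Yphi.1 YQ.1).
  apply: ae01S (ae01_and Yphi.2 YQ.2) => t _ [Y1 Y2].
  exact: (closed_subspaceB Ycl Y1 Y2).
have lB := L2_sumB lpsi Yphi.1.
have := L2_sum_dotDl lB Yd.1 Yd.1; rewrite phiP// add0r.
rewrite addrA subrK fibre_proj_orth// => /esym/(L2_sum_dot_self0 Yd.1)/(_ e).
by apply: ae01S => t _ /eqP; rewrite subr_eq0 => /eqP.
Qed.

(** Integration against a bounded scalar function commutes with the projection.
    Weak derivatives and boundary values are both expressed by such integrals,
    so this one identity transports them. *)
Lemma cintegral_fibre_proj psi u (C : R) e : L2_sum psi -> cmeasurable u ->
  (forall t, t \in `]0, 1[ -> sqmod (u t) <= C) ->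
  cintegral (fun t => u t * fibre_proj psi e t) =
  P (fun f => cintegral (fun t => u t * psi f t)) e.
Proof.
move=> lpsi mu_ uC; have lupsi := L2_sumM lpsi mu_ uC.
rewrite /P orth_proj_coord//; last exact: l2_cintegral.
rewrite -cintegral_l2_dot//; apply: cintegral_ae.
- by apply: cmeasurableM => //; exact: cmeasurable_fibre_proj.
- by apply: cintegrable_measurable; exact: (cintegrable_l2_dot lupsi (L2_sum_cst (lp e))).
apply: ae01S (L2_sum_ae_l2 lpsi) => t _ lt.
by rewrite -l2_dotZl.
Qed.

End Fibrewise.

(** * Functions with a weak derivative on the unit interval *)

Section Primitive.
Context {R : realType}.
Let mu := @lebesgue_measure R.
Local Notation J := (`]0%R, 1%R[%classic : set (measurableTypeR R)).
Local Notation L1 f := (mu.-integrable J (EFin \o f)).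
Let mJ := @measurable_unit R.
Implicit Types f g h : R -> R.

(** [g] is extended by zero, so that its integrability on the open interval gives
    integrability on the closed interval and on half-lines. *)
Definition primitive g (t : R) : R := \int[mu]_(s in `[0, t]) (g \_ J) s.

Lemma integrable_extend g : L1 g -> mu.-integrable setT (EFin \o (g \_ J)).
Proof.
by move=> ig; rewrite -restrict_EFin; apply/integrable_restrict => //=; rewrite setTI.
Qed.

Lemma integrable_extendS g (A : set (measurableTypeR R)) : measurable A -> L1 g ->
  mu.-integrable A (EFin \o (g \_ J)).
Proof. by move=> mA /integrable_extend; apply: integrableS. Qed.

Lemma primitive_continuous g : L1 g -> {within `[0, 1], continuous (primitive g)}.
Proof.
by move=> ig; apply: parameterized_integral_continuous => //; exact: integrable_extendS.
Qed.

Lemma primitive0 g : primitive g 0 = 0.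
Proof. by rewrite /primitive set_itv1 Rintegral_set1. Qed.

Lemma primitive1 g : primitive g 1 = \int[mu]_(s in J) g s.
Proof.
rewrite /primitive Rintegral_mkcond [RHS]Rintegral_mkcond; apply: eq_Rintegral => t _.
rewrite /patch; case: ifPn => // t01; case: ifPn => // /set_mem Jt; case/negP: t01.
rewrite inE /= in_itv/=; move: Jt; rewrite /= in_itv/= => /andP[t0 t1].
by rewrite (ltW t0) ltW.
Qed.

(** Integration by parts without differentiability: Fubini's theorem for
    [g s * h t] on the triangle [s < t]. *)
Lemma primitive_by_parts g h : L1 g -> L1 h ->
  \int[mu]_(t in J) (primitive g t * h t) =
  \int[mu]_(s in J) (g s * \int[mu]_(t in `]s, +oo[) (h \_ J) t).
Proof.
move=> ig ih; set gJ := g \_ J; set hJ := h \_ J.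
have igJ := integrable_extend ig; have ihJ := integrable_extend ih.
have mgJ : measurable_fun setT gJ by case/integrableP: igJ => /measurable_EFinP.
have mhJ : measurable_fun setT hJ by case/integrableP: ihJ => /measurable_EFinP.
pose f (x : measurableTypeR R * measurableTypeR R) : R :=
  if x.1 < x.2 then gJ x.1 * hJ x.2 else 0.
have mf : measurable_fun setT f.
  apply: measurable_fun_ifT.
  - by apply: measurable_fun_ltr; [exact: measurable_fst|exact: measurable_snd].
  - apply: measurable_funM.
      exact: (measurableT_comp mgJ measurable_fst).
    exact: (measurableT_comp mhJ measurable_snd).
  - exact: measurable_cst.
have mEf : measurable_fun setT (EFin \o f) by exact/measurable_EFinP.
have mf0 : measurable_fun setT (fun x : measurableTypeR R * measurableTypeR R => gJ x.1 * hJ x.2).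
  apply: measurable_funM.
    exact: (measurableT_comp mgJ measurable_fst).
  exact: (measurableT_comp mhJ measurable_snd).
have mEf0 : measurable_fun setT
    (EFin \o (fun x : measurableTypeR R * measurableTypeR R => gJ x.1 * hJ x.2)).
  exact/measurable_EFinP.
have i_f0 : (mu \x mu)%E.-integrable setT
    (EFin \o (fun x : measurableTypeR R * measurableTypeR R => gJ x.1 * hJ x.2)).
  apply/(integrable12ltyP _ _ mEf0).
  have /integrableP[_ gfin] := igJ; have /integrableP[mEh hfin] := ihJ.
  have E0 (s : R) : (\int[mu]_t `|(EFin \o (fun x : measurableTypeR R * measurableTypeR R =>
      gJ x.1 * hJ x.2)%R) (s, t)| = `|gJ s|%:E * \int[mu]_t `|(EFin \o hJ) t|)%E.
    rewrite -ge0_integralZl_EFin//; last exact: measurableT_comp.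
    by apply: eq_integral => t _; rewrite /= normrM EFinM.
  under eq_integral do rewrite E0.
  rewrite ge0_integralZr//=; last 2 first.
  - by apply/measurable_EFinP; exact: measurableT_comp.
  - exact: integral_ge0.
  by apply: lte_mul_pinfty => //; [exact: integral_ge0|rewrite ge0_fin_numE//; exact: integral_ge0].
have i_f : (mu \x mu)%E.-integrable setT (EFin \o f).
  apply: (le_integrable _ mEf _ i_f0) => // x _.
  by rewrite /= /f lee_fin; case: ifP => // _; rewrite normr0.
have := Fubini i_f.
have E1 (s : R) : (\int[mu]_t (EFin \o f) (s, t) =
    (gJ s * \int[mu]_(t in `]s, +oo[) hJ t)%:E)%E.
  have ih' : mu.-integrable `]s, +oo[ (EFin \o hJ).
    by apply: integrable_extendS => //; exact: measurable_itv.
  rewrite EFinM /Rintegral fineK; last exact: integrable_fin_num.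
  rewrite -integralZl//.
  rewrite [RHS]integral_mkcond; apply: eq_integral => t _.
  rewrite /= /f /patch /= -EFinM; case: ifPn => st.
    by rewrite mem_set//= in_itv/= st.
  by rewrite memNset//= in_itv/= andbT; exact/negP.
have E2 (t : R) : t \in `]0, 1[ -> (\int[mu]_s (EFin \o f) (s, t) =
    (primitive g t * hJ t)%:E)%E.
  rewrite in_itv/= => /andP[t0 t1].
  have ig' : mu.-integrable `[0, t[ (EFin \o gJ).
    by apply: integrable_extendS => //; exact: measurable_itv.
  rewrite /primitive -Rintegral_itv_bndo_bndc// mulrC EFinM /Rintegral fineK; last first.
    exact: integrable_fin_num.
  rewrite -integralZl//.
  rewrite [RHS]integral_mkcond; apply: eq_integral => s _.
  rewrite /= /f /patch /= -EFinM; case: ifPn => st; case: ifPn => ms; rewrite ?mulr0 1?mulrC//.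
    rewrite /gJ /patch; case: ifPn => [|_]; last by rewrite mulr0.
    rewrite inE /= in_itv/= => /andP[s0 s1]; case/negP: ms.
    by rewrite inE /= in_itv/= (ltW s0).
  by move: ms; rewrite inE /= in_itv/= (negbTE st) andbF.
under eq_integral do rewrite E1.
move=> E; rewrite /Rintegral [in RHS]integral_mkcond.
transitivity (fine (\int[mu]_t \int[mu]_s (EFin \o f) (s, t))); last first.
  rewrite -E; congr fine; apply: eq_integral => s _.
  by rewrite /gJ /patch; case: ifPn => // _; rewrite mul0r.
congr fine; rewrite [LHS]integral_mkcond; apply: eq_integral => t _.
rewrite /patch; case: ifPn => Jt.
  rewrite E2; last by move: Jt; rewrite inE.
  by rewrite /hJ /patch Jt.
rewrite (eq_integral (cst 0%E)) ?integral0// => s _.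
by rewrite /= /f /hJ /patch (negbTE Jt) mulr0 if_same.
Qed.


(** A continuous compactly supported function of mean zero is the derivative of a
    test function, whose values are its tail integrals up to sign. *)
Lemma test_function_primitive (w : R -> R) (a b : R) : 0 < a -> b < 1 ->
  continuous w -> (forall t, t \notin `[a, b] -> w t = 0) ->
  \int[mu]_(t in J) w t = 0 ->
  exists phi : R -> R, [/\ test_function phi, (phi^`())%classic = w &
    forall s, \int[mu]_(t in `]s, +oo[) (w \_ J) t = - phi s].
Proof.
move=> a0 b1 cw w0 intw.
have wJ : w \_ J = w.
  apply/funext => t; rewrite /patch; case: ifPn => // /negP Jt; rewrite w0//.
  apply/negP; rewrite in_itv/= => /andP[at_ tb]; apply: Jt.
  by rewrite inE /= in_itv/= (lt_le_trans a0 at_) (le_lt_trans tb b1).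
have iwab : mu.-integrable `[a, b] (EFin \o w).
  by apply: continuous_compact_integrable; [exact: segment_compact|exact: continuous_subspaceT].
have iw : mu.-integrable setT (EFin \o w).
  have -> : w = w \_ `[a, b].
    by apply/funext => t; rewrite /patch; case: ifPn => //; rewrite notin_setE /= => /negP /w0.
  by rewrite -restrict_EFin; apply/integrable_restrict => //=; rewrite setTI.
have intT : \int[mu]_t w t = 0 by rewrite -[RHS]intw [RHS]Rintegral_mkcond wJ.
have iS (A : set (measurableTypeR R)) : measurable A -> mu.-integrable A (EFin \o w).
  by move=> mA; apply: integrableS iw.
pose phi (t : R) := \int[mu]_(s in `]-oo, t]) w s.
have tail s : \int[mu]_(t in `]s, +oo[) w t = - phi s.
  have := @Rintegral_itvB R w -oo%O +oo%O s.
  rewrite set_itvNyy intT sub0r => <- //.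
have dphi x : derivable phi x 1 /\ (phi^`())%classic x = w x.
  apply: (@continuous_FTC1 R w -oo%O x (x + 1)) => //.
  - by rewrite ltrDl.
  - exact: iS.
  - exact: ltNyr.
  - exact: cw.
have phiw : (phi^`())%classic = w by apply/funext => x; case: (dphi x).
exists phi; split => //; last by rewrite wJ.
split.
- by move=> t; case: (dphi t).
- by rewrite phiw.
exists a, b; split => // t; rewrite in_itv/= negb_and -!ltNge => /orP[ta|bt].
  rewrite /phi (@eq_Rintegral _ _ _ _ _ (cst 0)).
    by rewrite /Rintegral integral0.
  move=> s; rewrite inE /= in_itv/= => st; rewrite w0// in_itv/= negb_and -ltNge.
  by rewrite (le_lt_trans st ta).
rewrite -[LHS]opprK -tail (@eq_Rintegral _ _ _ _ _ (cst 0)).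
  by rewrite /Rintegral integral0 oppr0.
move=> s; rewrite inE /= in_itv/= andbT => ts; rewrite w0// in_itv/= negb_and -!ltNge.
by rewrite (lt_trans bt ts) orbT.
Qed.

(** Continuous functions that increase to the indicator of ]a, b[ as the slope [n]
    of their sides grows. *)
Definition tent (a b : R) (n : nat) (t : R) : R :=
  Num.min 1 (n%:R * Num.max 0 (Num.min (t - a) (b - t))).

Lemma tent_continuous a b n : continuous (tent a b n).
Proof.
move=> t.
have c1 : {for t, continuous ((fun t => t - a) \min (fun t => b - t) : R -> R^o)}.
  by apply: continuous_min; apply: cvgB => //; exact: cvg_cst.
have c2 : {for t, continuous ((fun=> 0) \max ((fun t => t - a) \min (fun t => b - t)) : R -> R^o)}.
  by apply: continuous_max => //; exact: cvg_cst.
suff : {for t, continuous ((fun=> 1) \min (fun t => n%:R *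
    ((fun=> 0) \max ((fun t => t - a) \min (fun t => b - t))) t) : R -> R^o)} by [].
apply: continuous_min; first exact: cvg_cst.
by apply: cvgM; [exact: cvg_cst|exact: c2].
Qed.

Lemma tent_out a b n t : t \notin `]a, b[ -> tent a b n t = 0.
Proof.
rewrite in_itv/= negb_and -!leNgt => out; rewrite /tent.
rewrite (_ : Num.max 0 _ = 0) ?mulr0; first by apply/min_idPr.
by apply/max_idPl; rewrite ge_min !subr_le0.
Qed.

Lemma tent_ge0 a b n t : 0 <= tent a b n t.
Proof. by rewrite /tent le_min ler01 mulr_ge0// le_max lexx. Qed.

Lemma tent_le1 a b n t : tent a b n t <= 1.
Proof. by rewrite /tent ge_min lexx. Qed.

Lemma tent_cvg a b t : tent a b n t @[n --> \oo] --> (\1_`]a, b[ t : R).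
Proof.
rewrite indicE; case: (boolP (t \in `]a, b[)) => tab; last first.
  rewrite memNset /=; last exact/negP.
  rewrite (_ : (fun n => _) = fun=> 0); first exact: cvg_cst.
  by apply/funext => n; rewrite tent_out.
rewrite mem_set//=.
move: tab; rewrite in_itv/= => /andP[at_ tb].
set d := Num.min (t - a) (b - t).
have d0 : 0 < d by rewrite lt_min !subr_gt0 at_.
apply: cvg_near_cst; exists (Num.trunc d^-1).+1 => // n /= dn.
rewrite /tent -/d (max_idPr (ltW d0)); apply/min_idPl.
rewrite -ler_pdivrMr// mul1r; apply: ltW.
apply: lt_le_trans (_ : (Num.trunc d^-1).+1%:R <= _); last by rewrite ler_nat.
by apply: truncnS_gt.
Qed.

Let itv_subset (a b : R) : 0 < a -> b < 1 -> (`]a, b[%classic : set (measurableTypeR R)) `<=` J.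
Proof.
move=> a0 b1 t /=; rewrite !in_itv/= => /andP[at_ tb].
by rewrite (lt_trans a0 at_) (lt_trans tb b1).
Qed.

Lemma integral_tent_cvg (v : R -> R) (a b : R) : 0 < a -> b < 1 -> L1 v ->
  \int[mu]_(t in J) (v t * tent a b n t) @[n --> \oo] -->
  \int[mu]_(t in `]a, b[) v t.
Proof.
move=> a0 b1 iv.
have mv : measurable_fun J v by case/integrableP: iv => /measurable_EFinP.
have mt n : measurable_fun J (tent a b n).
  apply: measurable_funTS; apply: continuous_measurable_fun; exact: tent_continuous.
have mvt n : measurable_fun J (fun t => (v t * tent a b n t)%:E).
  by apply/measurable_EFinP; exact: measurable_funM.
have mvi : measurable_fun J (fun t => (v t * \1_`]a, b[ t)%:E).
  by apply/measurable_EFinP; apply: measurable_funM => //; exact: measurable_indic.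
have ivn : mu.-integrable J (EFin \o (fun t => `|v t|)) by exact: integrable_norm iv.
have [||ii _ icv] := dominated_convergence mJ mvt mvi _ ivn.
- apply: aeW => t _ /=; apply: cvg_EFin; first by apply: nearW.
  by apply: cvgM; [exact: cvg_cst|exact: tent_cvg].
- apply: aeW => t n _ /=; rewrite lee_fin normrM (ger0_norm (tent_ge0 _ _ _ _)).
  by rewrite ler_piMr// tent_le1.
have -> : \int[mu]_(t in `]a, b[) v t = fine (\int[mu]_(t in J) (v t * \1_`]a, b[ t)%:E)%E.
  rewrite /Rintegral integral_mkcond [in RHS]integral_mkcond; congr fine.
  apply: eq_integral => t _; rewrite /patch indicE; case: ifPn => tab.
    by rewrite (mem_set (itv_subset a0 b1 (set_mem tab))) mulr1.
  by rewrite mulr0 if_same.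
apply: fine_cvg; rewrite fineK//; exact: integrable_fin_num.
Qed.

Lemma Rintegral_itv1 (a b : R) : a < b -> \int[mu]_(t in `]a, b[) 1 = b - a.
Proof.
move=> ab; rewrite Rintegral_cst// mul1r.
by have := @lebesgue_measure_itv R `]a, b[; rewrite /= lte_fin ab /mu => ->.
Qed.

(** The lemma of du Bois-Reymond. Balancing the tents over two intervals gives a
    compactly supported [w] of mean zero; in the limit the mean of [v] is the same number
    [k] over all intervals. The primitive of [v - k] is therefore constant, and
    its derivative is [v - k] at almost every point. *)
Lemma du_bois_reymond (v : R -> R) : L1 v ->
  (forall (w : R -> R) (a b M : R), 0 < a -> b < 1 -> continuous w ->
    (forall t, `|w t| <= M) -> (forall t, t \notin `[a, b] -> w t = 0) -> \int[mu]_(t in J) w t = 0 ->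
    \int[mu]_(t in J) (v t * w t) = 0) ->
  exists k, ae01 (fun t => v t = k).
Proof.
move=> iv H.
have i1 : L1 (fun=> 1 : R).
  by have [] := square_integrable_cintegrable (square_integrable_cst (1 : R[i])).
have it n a b : L1 (tent a b n).
  apply: (le_integrable mJ _ _ i1).
    by apply/measurable_EFinP; apply: measurable_funTS; apply: continuous_measurable_fun; exact: tent_continuous.
  by move=> t _; rewrite /= lee_fin normr1 ger0_norm ?tent_le1 ?tent_ge0.
have ivt n a b : L1 (fun t => v t * tent a b n t).
  apply: (le_integrable mJ _ _ iv).
    apply/measurable_EFinP; apply: measurable_funM; first by case/integrableP: iv => /measurable_EFinP.
    by apply: measurable_funTS; apply: continuous_measurable_fun; exact: tent_continuous.
  move=> t _; rewrite /= lee_fin normrM (ger0_norm (tent_ge0 _ _ _ _)).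
  by rewrite ler_piMr// tent_le1.
have prop n a b a' b' : 0 < a -> b < 1 -> 0 < a' -> b' < 1 ->
  (\int[mu]_(t in J) tent a' b' n t) * (\int[mu]_(t in J) (v t * tent a b n t)) =
  (\int[mu]_(t in J) tent a b n t) * (\int[mu]_(t in J) (v t * tent a' b' n t)).
  move=> a0 b1 a'0 b'1.
  set m' := \int[mu]_(t in J) tent a' b' n t; set m := \int[mu]_(t in J) tent a b n t.
  pose w t := m' * tent a b n t - m * tent a' b' n t.
  have := H w (Num.min a a') (Num.max b b') (`|m'| + `|m|).
  rewrite lt_min a0 a'0 gt_max b1 b'1 => /(_ isT isT).
  have -> : \int[mu]_(t in J) (v t * w t) =
      m' * \int[mu]_(t in J) (v t * tent a b n t) - m * \int[mu]_(t in J) (v t * tent a' b' n t).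
    rewrite -!RintegralZl// -RintegralB//; [|exact: integrableZ|exact: integrableZ].
    by apply: eq_Rintegral => t _; rewrite /w; ring.
  move=> h; apply/eqP; rewrite -subr_eq0; apply/eqP; apply: h.
  - move=> t; apply: cvgB; apply: cvgM; try exact: cvg_cst; exact: tent_continuous.
  - move=> t; rewrite (le_trans (ler_normB _ _))// !normrM.
    by apply: lerD; rewrite ler_piMr// ger0_norm ?tent_le1 ?tent_ge0.
  - move=> t; rewrite in_itv/= negb_and -!ltNge lt_min gt_max => out.
    rewrite /w !tent_out ?mulr0 ?subr0//; rewrite in_itv/= negb_and -!leNgt;
      by case/orP: out => /andP[h1 h2]; rewrite (ltW h1, ltW h2) ?(ltW h1) ?(ltW h2) ?orbT.
  - rewrite RintegralB//; [|exact: integrableZ|exact: integrableZ].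
    by rewrite !RintegralZl// -/m -/m' mulrC subrr.
have mt n a b : \int[mu]_(t in J) tent a b n t = \int[mu]_(t in J) (1 * tent a b n t).
  by apply: eq_Rintegral => t _; rewrite mul1r.
have prop_lim a b a' b' : 0 < a -> b < 1 -> 0 < a' -> b' < 1 ->
  (\int[mu]_(t in `]a', b'[) 1) * (\int[mu]_(t in `]a, b[) v t) =
  (\int[mu]_(t in `]a, b[) 1) * (\int[mu]_(t in `]a', b'[) v t).
  move=> a0 b1 a'0 b'1.
  have c1 : (\int[mu]_(t in J) (1 * tent a' b' n t)) * (\int[mu]_(t in J) (v t * tent a b n t))
      @[n --> \oo] --> (\int[mu]_(t in `]a', b'[) 1) * (\int[mu]_(t in `]a, b[) v t).
    by apply: cvgM; exact: integral_tent_cvg.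
  have c2 : (\int[mu]_(t in J) (1 * tent a b n t)) * (\int[mu]_(t in J) (v t * tent a' b' n t))
      @[n --> \oo] --> (\int[mu]_(t in `]a, b[) 1) * (\int[mu]_(t in `]a', b'[) v t).
    by apply: cvgM; exact: integral_tent_cvg.
  apply: (cvg_unique _ c1); first exact: Rhausdorff.
  move: c2; rewrite [X in X @ _ --> _](_ : _ = fun n =>
      (\int[mu]_(t in J) (1 * tent a' b' n t)) * (\int[mu]_(t in J) (v t * tent a b n t)))//.
  by apply/funext => n; rewrite -!mt prop.
(* The reference interval ]1/4, 3/4[ has length 1/2, whence the factor 2. *)
pose k := 2 * \int[mu]_(t in `]4^-1, 3 / 4[) v t.
have int_k a b : 0 < a -> a < b -> b < 1 -> \int[mu]_(t in `]a, b[) v t = k * (b - a).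
  move=> a0 ab b1.
  have q0 : 0 < 4^-1 :> R by lra.
  have q1 : 3 / 4 < 1 :> R by lra.
  have q2 : 4^-1 < 3 / 4 :> R by lra.
  have := prop_lim a b 4^-1 (3 / 4) a0 b1 q0 q1; rewrite (Rintegral_itv1 q2) (Rintegral_itv1 ab) /k.
  by move: (Rintegral _ _ _) (Rintegral _ _ _) => x y; lra.
have mv : measurable_fun J v by case/integrableP: iv => /measurable_EFinP.
have ik : L1 (fun t => v t - k).
  have := integrableB mJ iv (integrableZ k i1).
  by apply: eq_integrable => // t _; rewrite /= mulr1.
pose f := (fun t => v t - k) \_ J.
have i_f := integrable_extend ik.
have ify y : mu.-integrable `]-oo, y] (EFin \o f) by exact: integrable_extendS.
have loc : locally_integrable setT f by exact: integrable_locally.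
have := FTC1Ny ify loc.
set F := fun x => \int[mu]_(t in _) f t => aeF.
have Fcst x y : 0 < x -> x < y -> y < 1 -> F x = F y.
  move=> x0 xy y1; apply/esym/eqP; rewrite -subr_eq0; apply/eqP.
  rewrite /F Rintegral_itvB//; last by rewrite bnd_simp ltW.
  rewrite -Rintegral_itv_bndo_bndc; last by exact: integrable_extendS.
  transitivity (\int[mu]_(t in `]x, y[) (v t - k * 1)).
    apply: eq_Rintegral => t /set_mem txy; rewrite /f /patch mulr1 mem_set//.
    exact: (itv_subset x0 y1).
  have sub := itv_subset x0 y1.
  rewrite RintegralB//; last 2 first.
  - exact: integrableS iv.
  - exact: integrableS (integrableZ k i1).
  rewrite int_k// RintegralZl//; last exact: integrableS i1.
  by rewrite Rintegral_itv1// subrr.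
exists k; apply: ae01S (ae01W aeF).
move=> t; rewrite in_itv/= => /andP[t0 t1] [_].
have -> : (F^`())%classic t = 0.
  rewrite derive1E (@near_eq_derive _ _ _ F (fun=> F t) t 1).
    exact: derive_cst.
  near=> y.
  have y0 : 0 < y by near: y; exact: lt_nbhsr.
  have y1 : y < 1 by near: y; exact: lt_nbhsl.
  case: (ltgtP y t) => [yt|ty|-> //]; first exact: Fcst.
  by apply/esym; exact: Fcst.
rewrite /f /patch mem_set /=; last by rewrite in_itv/= t0.
by move=> /esym/eqP; rewrite subr_eq0 => /eqP.
Unshelve. all: by end_near. Qed.

Lemma integrable_mul_bounded (f w : R -> R) (M : R) : L1 f -> measurable_fun J w ->
  (forall t, t \in `]0, 1[ -> `|w t| <= M) -> L1 (fun t => f t * w t).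
Proof.
move=> i_f mw wM; apply: (le_integrable mJ _ _ (integrableZ M i_f)).
  apply/measurable_EFinP; apply: measurable_funM => //.
  by case/integrableP: i_f => /measurable_EFinP.
move=> t Jt; rewrite /= lee_fin !normrM mulrC ler_wpM2r//.
exact: le_trans (wM t Jt) (ler_norm M).
Qed.

(** A function with weak derivative [g] is a primitive of [g]. The difference of
    both annihilates all derivatives of test functions, so it is constant; the
    constant is found by integrating over the interval, where the mean of the
    primitive is the integral of [g s * (1 - s)]. *)
Lemma weak_derivative_primitive (u g : R -> R) : L1 u -> L1 g ->
  (forall phi, test_function phi ->
    \int[mu]_(t in J) (u t * (phi^`())%classic t) = - \int[mu]_(t in J) (g t * phi t)) ->
  ae01 (fun t => u t = \int[mu]_(s in J) u s - \int[mu]_(s in J) (g s * (1 - s)) + primitive g t).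
Proof.
move=> iu ig ug; set c := _ - _.
have i1 : L1 (fun=> 1 : R).
  by have [] := square_integrable_cintegrable (square_integrable_cst (1 : R[i])).
have iG : L1 (primitive g).
  apply: (@integrableS _ _ _ mu `[0, 1]) => //; last first.
    by apply: continuous_compact_integrable; [exact: segment_compact|exact: primitive_continuous].
  by move=> t /=; rewrite !in_itv/= => /andP[t0 t1]; rewrite !ltW.
pose v t := u t - c * 1 - primitive g t.
have iv : L1 v.
  have := integrableB mJ (integrableB mJ iu (integrableZ c i1)) iG.
  by apply: eq_integrable.
have mv : measurable_fun J v by case/integrableP: iv => /measurable_EFinP.
have [w a b M a0 b1 cw wM w0 intw|k vk] := du_bois_reymond iv.
  have mw : measurable_fun J w.
    by apply: measurable_funTS; apply: continuous_measurable_fun.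
  have iuw := integrable_mul_bounded iu mw (fun t _ => wM t).
  have iGw := integrable_mul_bounded iG mw (fun t _ => wM t).
  have iw : L1 w.
    by have := integrable_mul_bounded i1 mw (fun t _ => wM t); apply: eq_integrable => // t _; rewrite /= mul1r.
  have iw' := integrableZ c iw.
  transitivity (\int[mu]_(t in J) (u t * w t - c * w t - primitive g t * w t)).
    by apply: eq_Rintegral => t _; rewrite /v; ring.
  rewrite RintegralB//; last exact: (integrableB mJ iuw iw').
  rewrite RintegralB// RintegralZl// intw mulr0 subr0.
  have [phi [tphi phi' phiw]] : exists phi : R -> R, [/\ test_function phi,
      (phi^`())%classic = (fun t => - w t) &
      forall s, \int[mu]_(t in `]s, +oo[) ((fun t => - w t) \_ J) t = - phi s].
    apply: (test_function_primitive a0 b1).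
    - by move=> t; apply: cvgN; exact: cw.
    - by move=> t /w0 ->; rewrite oppr0.
    - rewrite (_ : (fun t => - w t) = (fun t => -1 * w t)).
        by rewrite RintegralZl// intw mulr0.
      by apply/funext => t; rewrite mulN1r.
  rewrite primitive_by_parts//.
  transitivity (\int[mu]_(t in J) (u t * w t) - \int[mu]_(s in J) (g s * phi s)).
    congr (_ - _); apply: eq_Rintegral => s _; congr (_ * _).
    rewrite -[phi s]opprK -phiw.
    have iws : mu.-integrable `]s, +oo[ (EFin \o (w \_ J)) by exact: integrable_extendS.
    apply/eqP; rewrite -eqr_oppLR -mulN1r -RintegralZl//; apply/eqP.
    apply: eq_Rintegral => t _; rewrite /patch; case: ifPn => _; first by rewrite mulN1r.
    by rewrite mulr0.
  have := ug _ tphi; rewrite phi' => e.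
  rewrite -[X in _ - X]opprK -e opprK -RintegralD//.
    transitivity (\int[mu]_(t in J) (0 : R)); last by rewrite /Rintegral integral0.
    by apply: eq_Rintegral => t _; rewrite mulrN subrr.
  have := integrableZ (-1) iuw; apply: eq_integrable => // t _ /=.
  by rewrite mulN1r mulrN.
have k0 : k = 0.
  have int1 : \int[mu]_(t in J) 1 = 1 :> R by rewrite /Rintegral integral_unit_cst.
  have -> : k = \int[mu]_(t in J) v t.
    have ck : cmeasurable (fun t => (v t)%:C) by exact: cmeasurableC.
    have := cintegral_ae ck (cmeasurable_cst k%:C).
    rewrite cintegral_cst => h; apply/esym; apply: (congr1 (@complex.Re R) (h _)).
    by apply: ae01S vk => t _ ->.
  rewrite RintegralB//; last first.
    have := integrableB mJ iu (integrableZ c i1).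
    by apply: eq_integrable.
  rewrite RintegralB//; last exact: integrableZ.
  rewrite RintegralZl// int1.
  have -> : \int[mu]_(t in J) primitive g t = \int[mu]_(s in J) (g s * (1 - s)).
    transitivity (\int[mu]_(t in J) (primitive g t * 1)).
      by apply: eq_Rintegral => t _; rewrite mulr1.
    rewrite primitive_by_parts//; apply: eq_Rintegral => s /set_mem /=.
    rewrite in_itv/= => /andP[s0 s1]; congr (_ * _).
    transitivity (\int[mu]_(t in `]s, 1[) 1 : R).
      rewrite [LHS]Rintegral_mkcond [RHS]Rintegral_mkcond; apply: eq_Rintegral => t _.
      rewrite /patch; case: ifPn => [/set_mem /=|/negP ns].
        rewrite in_itv/= andbT => st.
        have -> // : (t \in J) = (t \in (`]s, 1[%classic : set (measurableTypeR R))).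
        apply/idP/idP => /set_mem /=; rewrite in_itv/= => /andP[t0 t1]; apply: mem_set;
          by rewrite /= in_itv/= t1 ?st ?(lt_trans s0).
      case: ifPn => // /set_mem /=; rewrite in_itv/= => /andP[st _].
      by case: ns; apply: mem_set; rewrite /= in_itv/= st.
    exact: Rintegral_itv1.
  by rewrite /c; ring.
apply: ae01S vk => t _; rewrite k0 /v mulr1 => /eqP; rewrite subr_eq0 subr_eq.
by rewrite addrC => /eqP.
Qed.

End Primitive.

(** * Boundary values *)

Section BoundaryValues.
Context {R : realType}.
Let mu := @lebesgue_measure R.
Local Notation J := (`]0%R, 1%R[%classic : set (measurableTypeR R)).
Local Notation L1 f := (mu.-integrable J (EFin \o f)).
Let mJ := @measurable_unit R.

(** A null set contains no interval. *)
Lemma ae01_exists (P : R -> Prop) (a b : R) : 0 <= a -> a < b -> b <= 1 ->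
  ae01 P -> exists2 t, a < t < b & P t.
Proof.
move=> a0 ab b1 [A [mA A0 PA]]; apply: contrapT => nP.
have sub : (`]a, b[%classic : set (measurableTypeR R)) `<=` A.
  move=> t /=; rewrite in_itv/= => tab; apply: PA => /= Pt.
  apply: nP; exists t => //; apply: Pt; rewrite in_itv/=.
  by case/andP: tab => at_ tb; rewrite (le_lt_trans a0 at_) (lt_le_trans tb b1).
have := @lebesgue_measure_itv R `]a, b[; rewrite /= lte_fin ab => e.
have : (mu (`]a, b[%classic : set (measurableTypeR R)) <= mu A)%E.
  by apply: le_measure => //; rewrite inE.
by rewrite /mu A0 e -EFinB lee_fin subr_le0 leNgt ab.
Qed.

Lemma ae_eq_continuous_ends (v w : R -> R) :
  {within `[0, 1], continuous v} -> {within `[0, 1], continuous w} ->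
  ae01 (fun t => v t = w t) -> v 0 = w 0 /\ v 1 = w 1.
Proof.
move=> cv cw vw; pose d t := v t - w t.
have cd : {within `[0, 1], continuous d} by move=> t; apply: cvgB; [exact: cv|exact: cw].
have [_ d0 d1] := (continuous_within_itvP d ltr01).1 cd.
suff [e0 e1] : d 0 = 0 /\ d 1 = 0 by split; apply/eqP; rewrite -subr_eq0; apply/eqP.
split; apply: contrapT => /eqP nz.
- have := cvgr_neq0 _ d0 nz => -[e /= e0 He].
  have m0 : 0 < Num.min e 1 by rewrite lt_min e0 ltr01.
  have [|t /andP[t0 te] vwt] := ae01_exists (lexx 0) m0 _ vw; first by rewrite ge_min lexx orbT.
  have := He t; rewrite /= sub0r normrN gtr0_norm// => h.
  have te' : t < e by move: te; rewrite lt_min => /andP[].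
  have/eqP := h te' t0.
  by rewrite /d vwt subrr.
- have := cvgr_neq0 _ d1 nz => -[e /= e0 He].
  have m0 : Num.max (1 - e) 0 < 1 by rewrite gt_max ltr01 andbT ltrBlDr ltrDl.
  have [|t /andP[t0 te] vwt] := ae01_exists _ m0 (lexx 1) vw; first by rewrite le_max lexx orbT.
  move: t0; rewrite gt_max => /andP[t0 _].
  have := He t; rewrite /= gtr0_norm ?subr_gt0// => h.
  have/eqP := h ltac:(lra) te.
  by rewrite /d vwt subrr.
Qed.

Lemma continuous_rep_ends (f v : R -> R[i]) :
  {within `[0, 1], continuous (fun t => Re (v t))} ->
  {within `[0, 1], continuous (fun t => Im (v t))} ->
  ae01 (fun t => f t = v t) ->
  continuous_rep f 0 = v 0 /\ continuous_rep f 1 = v 1.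
Proof.
move=> cr ci fv.
have [wr wi fw] := @xgetI _ 0 [set v : R -> R[i] | [/\
   {within `[0, 1], continuous (fun t : R => Re (v t))},
   {within `[0, 1], continuous (fun t : R => Im (v t))} & ae01 (fun t => f t = v t)]] v
   (And3 cr ci fv).
rewrite -/(continuous_rep f) in wr wi fw *.
have E : ae01 (fun t => continuous_rep f t = v t).
  by apply: ae01S (ae01_and fv fw) => t _ [<- <-].
have [r0 r1] := ae_eq_continuous_ends wr cr (ae01S (fun t _ e => congr1 (@complex.Re R) e) E).
have [i0 i1] := ae_eq_continuous_ends wi ci (ae01S (fun t _ e => congr1 (@complex.Im R) e) E).
by split; apply: complex_eq.
Qed.

(** Boundary values are integrals of the function and its weak derivative against
    bounded functions. In this form they are visibly bounded functionals and
    they commute with the fibrewise projection, with no need to estimate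
    continuous representatives uniformly over all edges. *)
Lemma continuous_rep_boundary (f g : R -> R[i]) : cintegrable f -> cintegrable g ->
  weak_derivative f g ->
  continuous_rep f 0 = cintegral f - cintegral (fun t => (1 - t)%:C * g t) /\
  continuous_rep f 1 = cintegral f + cintegral (fun t => t%:C * g t).
Proof.
move=> [fr fi] [gr gi] fg.
have wr phi : test_function phi ->
    \int[mu]_(t in J) (Re (f t) * (phi^`())%classic t) = - \int[mu]_(t in J) (Re (g t) * phi t).
  move=> /fg/(congr1 (@complex.Re R)); rewrite !reimE /cintegral/=.
  have E (k : R -> R[i]) (h : R -> R) :
      \int[mu]_(t in J) Re (k t * (h t)%:C) = \int[mu]_(t in J) (Re (k t) * h t).
    by apply: eq_Rintegral => t _; rewrite !reimE !reCE mulr0 subr0.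
  by rewrite !E.
have wi phi : test_function phi ->
    \int[mu]_(t in J) (Im (f t) * (phi^`())%classic t) = - \int[mu]_(t in J) (Im (g t) * phi t).
  move=> /fg/(congr1 (@complex.Im R)); rewrite !reimE /cintegral/=.
  have E (k : R -> R[i]) (h : R -> R) :
      \int[mu]_(t in J) Im (k t * (h t)%:C) = \int[mu]_(t in J) (Im (k t) * h t).
    by apply: eq_Rintegral => t _; rewrite !reimE !reCE mulr0 add0r.
  by rewrite !E.
have ur := weak_derivative_primitive fr gr wr.
have ui := weak_derivative_primitive fi gi wi.
set cr := _ - _ in ur; set ci := _ - _ in ui.
pose v t := (cr + primitive (fun t => Re (g t)) t) +i* (ci + primitive (fun t => Im (g t)) t).
have [|||->] := @continuous_rep_ends f v.
- by move=> t; apply: cvgD; [exact: cvg_cst|exact: (primitive_continuous gr)].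
- by move=> t; apply: cvgD; [exact: cvg_cst|exact: (primitive_continuous gi)].
- by apply: ae01S (ae01_and ur ui) => t _ [er ei]; apply: complex_eq.
have E0 (k : R -> R) : \int[mu]_(t in J) (k t * (1 - t)) = \int[mu]_(t in J) ((1 - t) * k t).
  by apply: eq_Rintegral => t _; rewrite mulrC.
have mid : measurable_fun J (fun t : R => t) by exact: measurable_id.
have mc : measurable_fun J (fun t : R => 1 - t).
  by apply: measurable_funB => //; exact: measurable_cst.
have bid (t : R) : t \in `]0, 1[ -> `|t| <= 1.
  by rewrite in_itv/= => /andP[t0 t1]; rewrite ger0_norm ltW.
have bc (t : R) : t \in `]0, 1[ -> `|1 - t| <= 1.
  by rewrite in_itv/= => /andP[t0 t1]; rewrite ger0_norm; lra.
have E1 (k : R -> R) : L1 k -> - (\int[mu]_(t in J) (k t * (1 - t))) + \int[mu]_(t in J) k t =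
    \int[mu]_(t in J) (t * k t).
  move=> ik; rewrite addrC -RintegralB//; last exact: (integrable_mul_bounded ik mc bc).
  by apply: eq_Rintegral => t _; ring.
have ReZ (h : R -> R) : Re (cintegral (fun t => (h t)%:C * g t)) =
    \int[mu]_(t in J) (h t * Re (g t)).
  by apply: eq_Rintegral => t _; rewrite !reimE !reCE mul0r subr0.
have ImZ (h : R -> R) : Im (cintegral (fun t => (h t)%:C * g t)) =
    \int[mu]_(t in J) (h t * Im (g t)).
  by apply: eq_Rintegral => t _; rewrite !reimE !reCE mul0r addr0.
move=> ->; rewrite /v !primitive0 !primitive1 !addr0; split; apply: complex_eq.
- by rewrite ReD ReN ReZ -E0.
- by rewrite ImD ImN ImZ -E0.
- by rewrite ReD ReZ -E1// addrA.
- by rewrite ImD ImZ -E1// addrA.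
Qed.

End BoundaryValues.

Section Affine.
Context {R : realType}.
Let mu := @lebesgue_measure R.
Local Notation J := (`]0%R, 1%R[%classic : set (measurableTypeR R)).
Let mJ := @measurable_unit R.

(** The simplest function on an edge with given boundary values; it embeds the
    range of the incidence operator into the form domain. *)
Definition affine (a b : R[i]) (t : R) : R[i] := (1 - t)%:C * a + t%:C * b.

Let raffine (a b t : R) : R := (1 - t) * a + t * b.

Let raffine_derive (a b t : R) : is_derive t 1 (raffine a b) (b - a).
Proof.
rewrite /raffine; apply: is_derive_eq; rewrite /GRing.scale/=; ring.
Qed.

Let raffine_continuous (a b : R) : continuous (raffine a b).
Proof.
move=> t; apply: cvgD; apply: cvgM; try exact: cvg_cst; last exact: cvg_id.
by apply: cvgB; [exact: cvg_cst|exact: cvg_id].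
Qed.

Let Re_affine (a b : R[i]) t : Re (affine a b t) = raffine (Re a) (Re b) t.
Proof. by rewrite /affine !reimE !reCE !mul0r !subr0. Qed.

Let Im_affine (a b : R[i]) t : Im (affine a b t) = raffine (Im a) (Im b) t.
Proof. by rewrite /affine !reimE !reCE !mul0r !addr0. Qed.

Lemma continuous_rep_affine (f : R -> R[i]) (a b : R[i]) :
  ae01 (fun t => f t = affine a b t) ->
  continuous_rep f 0 = a /\ continuous_rep f 1 = b.
Proof.
move=> /continuous_rep_ends[||-> ->].
- apply: continuous_subspaceT => t; under eq_fun do rewrite Re_affine.
  exact: raffine_continuous.
- apply: continuous_subspaceT => t; under eq_fun do rewrite Im_affine.
  exact: raffine_continuous.
by split; apply: complex_eq; rewrite ?(Re_affine, Im_affine) /raffine; ring.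
Qed.

Let raffine_by_parts (a b : R) (phi : R -> R) : test_function phi ->
  \int[mu]_(t in J) (raffine a b t * (phi^`())%classic t) =
  - \int[mu]_(t in J) ((b - a) * phi t).
Proof.
move=> [dphi cphi [a' [b' [a'0 b'1 phi0]]]].
have p0 : phi 0 = 0 by apply: phi0; rewrite in_itv/= leNgt a'0.
have p1 : phi 1 = 0 by apply: phi0; rewrite in_itv/= negb_and -!ltNge b'1 orbT.
have contphi : continuous phi.
  by move=> t; apply: differentiable_continuous; exact/derivable1_diffP.
have LR (h : R -> R) : (forall t, derivable h t 1) -> continuous h ->
    derivable_oo_LRcontinuous h 0 1.
  move=> dh ch; split => //; [exact: cvg_at_right_filter (ch 0)|exact: cvg_at_left_filter (ch 1)].
have da t : derivable (raffine a b) t 1 by case: (raffine_derive a b t).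
have := @Rintegration_by_parts R (raffine a b) phi (fun=> b - a) (phi^`())%classic 0 1 ltr01.
rewrite p0 p1 !mulr0 subrr sub0r => H.
have oo (h : R -> R) : continuous h -> \int[mu]_(t in J) h t = \int[mu]_(t in `[0, 1]) h t.
  move=> ch; have ih : mu.-integrable `[0, 1] (EFin \o h).
    by apply: continuous_compact_integrable; [exact: segment_compact|exact: continuous_subspaceT].
  have ih' : mu.-integrable `[0, 1[ (EFin \o h).
    by apply: integrableS ih => //; apply: subset_itvl; rewrite bnd_simp.
  rewrite -Rintegral_itv_bndo_bndc//; rewrite -Rintegral_itv_obnd_cbnd//.
  by apply: integrableS ih' => //; apply: subset_itvr; rewrite bnd_simp.
rewrite !oo; first apply: H.
- by apply: continuous_subspaceT => t; exact: cvg_cst.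
- exact: LR.
- by move=> t _; rewrite derive1E; case: (raffine_derive a b t).
- exact: (continuous_subspaceT cphi).
- exact: LR.
- by [].
- by move=> t; apply: cvgM; [exact: cvg_cst|exact: contphi].
- by move=> t; apply: cvgM; [exact: raffine_continuous|exact: cphi].
Qed.

Lemma weak_derivative_affine (a b : R[i]) : weak_derivative (affine a b) (fun=> b - a).
Proof.
move=> phi tphi; apply: complex_eq; rewrite !reimE /cintegral/=.
  transitivity (\int[mu]_(t in J) (raffine (Re a) (Re b) t * (phi^`())%classic t)).
    by apply: eq_Rintegral => t _; rewrite ReM !reCE mulr0 subr0 Re_affine.
  rewrite raffine_by_parts//; congr (- _); apply: eq_Rintegral => t _.
  by rewrite ReM !reCE mulr0 subr0 ReD ReN.
transitivity (\int[mu]_(t in J) (raffine (Im a) (Im b) t * (phi^`())%classic t)).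
  by apply: eq_Rintegral => t _; rewrite ImM !reCE mulr0 add0r Im_affine.
rewrite raffine_by_parts//; congr (- _); apply: eq_Rintegral => t _.
by rewrite ImM !reCE mulr0 add0r ImD ImN.
Qed.

Lemma cmeasurable_id : cmeasurable (fun t : R => t%:C).
Proof. by apply: cmeasurableC; exact: measurable_id. Qed.

Lemma cmeasurable_onem : cmeasurable (fun t : R => (1 - t)%:C).
Proof. by apply: cmeasurableC; apply: measurable_funB => //; exact: measurable_cst. Qed.

Lemma sqmod_id_le1 (t : R) : t \in `]0, 1[ -> sqmod t%:C <= 1.
Proof. by rewrite in_itv/= sqmodC => /andP[t0 t1]; rewrite expr_le1// ltW. Qed.

Lemma sqmod_onem_le1 (t : R) : t \in `]0, 1[ -> sqmod (1 - t)%:C <= 1.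
Proof. by rewrite in_itv/= sqmodC => /andP[t0 t1]; rewrite expr_le1//; lra. Qed.

Lemma L2_sum_affine (I : countType) (a b : I -> R[i]) : l2 R I a -> l2 R I b ->
  L2_sum (fun e => affine (a e) (b e)).
Proof.
move=> la lb; apply: (L2_sumD (psi := fun e t => (1 - t)%:C * a e)
  (phi := fun e t => t%:C * b e)).
  exact: (L2_sumM (L2_sum_cst la) cmeasurable_onem sqmod_onem_le1).
exact: (L2_sumM (L2_sum_cst lb) cmeasurable_id sqmod_id_le1).
Qed.

End Affine.

(** * Bases consisting of eigenvectors *)

Section LinearAlgebra.
Context {K : fieldType} {X : lmodType K}.
Implicit Types (B S W : set X) (x y : X).

Definition subspace W : Prop := W 0 /\ forall (a : K) x y, W x -> W y -> W (a *: x + y).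

Lemma subspace_sum W (F : {fset X}) (c : X -> K) : subspace W -> [set` F] `<=` W ->
  W (\sum_(b <- F) c b *: b).
Proof.
move=> [W0 Wlin] FW; rewrite big_seq.
apply: (big_ind W) => // [x y Wx Wy|b /FW Wb].
  by have := Wlin 1 _ _ Wx Wy; rewrite scale1r.
by have := Wlin (c b) _ _ Wb W0; rewrite addr0.
Qed.

(** To prove a property of all vectors in a span, it suffices that the vectors with
    this property form a subspace containing the generators. *)
Lemma linear_span_sub S W : subspace W -> S `<=` W -> linear_span S `<=` W.
Proof.
move=> sW SW _ [F [c [FS ->]]].
by apply: subspace_sum => // x Fx; apply: SW; exact: FS.
Qed.

Lemma linear_span_incl S : S `<=` linear_span S.
Proof.
move=> x Sx; exists [fset x]%fset, (fun=> 1); split.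
  by move=> y /=; rewrite inE => /eqP ->.
by rewrite big_seq_fset1 scale1r.
Qed.

Lemma subspace_linear_span S : subspace (linear_span S).
Proof.
split; first by exists fset0, (fun=> 0); split => //; rewrite big_seq_fset0.
move=> a _ _ [F [c [FS ->]]] [F' [c' [FS' ->]]].
exists (F `|` F')%fset, (fun b => (if b \in F then a * c b else 0) + (if b \in F' then c' b else 0)).
split; first by move=> x /=; rewrite in_fsetU => /orP[/FS|/FS'].
under [RHS]eq_bigr do rewrite scalerDl.
rewrite big_split/=; congr (_ + _).
  rewrite scaler_sumr -(big_fset_incl _ (fsubsetUl F F')); last first.
    by move=> x _ /negbTE ->; rewrite scale0r.
  by apply: eq_big_seq => x ->; rewrite scalerA.
rewrite -(big_fset_incl _ (fsubsetUr F F')); last first.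
  by move=> x _ /negbTE ->; rewrite scale0r.
by apply: eq_big_seq => x ->.
Qed.

Lemma linearly_independent_setU1 B x : linearly_independent B ->
  ~ linear_span B x -> linearly_independent (B `|` [set x]).
Proof.
move=> iB nx F c FB sum0.
have [xF|xF] := boolP (x \in F); last first.
  apply: iB sum0 => y /= yF; case: (FB y yF) => // /= yx.
  by rewrite -yx yF in xF.
have FxB : [set` (F `\ x)%fset] `<=` B.
  by move=> y /=; rewrite in_fsetD1 => /andP[/eqP yx /FB[]].
move: sum0; rewrite (big_fsetD1 x xF)/=.
have [cx0|cx] := eqVneq (c x) 0.
  rewrite cx0 scale0r add0r => /(iB _ _ FxB) h b bF.
  by have [->//|bx] := eqVneq b x; apply: h; rewrite in_fsetD1 bx.
move=> /eqP; rewrite addr_eq0 => /eqP e; case: nx.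
have [S0 Slin] := subspace_linear_span B.
have -> : x = (- (c x)^-1) *: (\sum_(b <- (F `\ x)%fset) c b *: b) + 0.
  by rewrite addr0 scaleNr -scalerN -e scalerA mulVf// scale1r.
apply: Slin => //; apply: subspace_sum; first exact: subspace_linear_span.
by move=> y /FxB; exact: linear_span_incl.
Qed.

(** Every spanning set contains a basis: by Zorn's lemma there is a maximal
    independent subset, since a finite part of the union of a chain lies in one
    member of the chain. *)
Lemma basis_in_spanning_set S : exists2 B, B `<=` S & algebraic_basis B (linear_span S).
Proof.
have [//|B [[BS iB] Bmax]] := @Zorn_bigcup X [set B | B `<=` S /\ linearly_independent B].
  move=> C CP Ctot; split; first by move=> x [B /CP[BS _]]; exact: BS.
  have fin (s : seq X) : {in s, forall x, (\bigcup_(B in C) B) x} ->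
      s = [::] \/ exists2 B, C B & {in s, forall x, B x}.
    elim: s => [|x s ih] h; first by left.
    right; have [B CB Bx] := h x (mem_head _ _).
    have [|->|[B' CB' B's]] := ih.
    - by move=> y ys; apply: h; rewrite in_cons ys orbT.
    - by exists B => // y; rewrite inE => /eqP ->.
    have [BB'|B'B] := Ctot _ _ CB CB'.
      by exists B' => // y; rewrite in_cons => /orP[/eqP ->|/B's//]; exact: BB'.
    by exists B => // y; rewrite in_cons => /orP[/eqP -> //|/B's]; exact: B'B.
  move=> F c FC sum0 b bF.
  have [F0|[B CB FB]] := fin F FC; first by move: bF; rewrite -[b \in F]/(b \in enum_fset F) F0.
  by have [_ iB] := CP _ CB; apply: (iB F c) => //.
exists B => //; split => //; apply/seteqP; split.
  apply: linear_span_sub; first exact: subspace_linear_span.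
  by move=> x /BS; exact: linear_span_incl.
apply: linear_span_sub; first exact: subspace_linear_span.
move=> x Sx; apply: contrapT => nx.
apply: (Bmax (B `|` [set x])).
  split; first by move=> y; left.
  by move=> h; apply: nx; apply: linear_span_incl; apply: h; right.
split; last exact: linearly_independent_setU1.
by move=> y [/BS//|->].
Qed.

(** For a linear idempotent on [W], the vectors [T x] and [x - T x] are fixed and
    annihilated by [T], respectively. If [W] is invariant, both lie in [W], so
    the eigenvectors in [W] span it and contain a basis; conversely the span of
    eigenvectors is invariant. *)
Lemma invariant_iff_eigenbasis W (T : X -> X) : subspace W ->
  (forall (a : K) x y, W x -> W y -> T (a *: x + y) = a *: T x + T y) ->
  (forall x, W x -> T (T x) = T x) ->
  T @` W `<=` W <->
  exists B, algebraic_basis B W /\ forall x, B x -> eigenvector T x.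
Proof.
move=> sW Tlin Tid; have [W0 Wlin] := sW.
have T0 : T 0 = 0.
  by have := Tlin (-1) 0 0 W0 W0; rewrite scaler0 addr0 scaleN1r addNr.
split => [TW|[B [[iB spanB] eigB]]].
  pose S := [set x | W x /\ eigenvector T x].
  have [B BS [iB spanB]] := basis_in_spanning_set S.
  exists B; split => [|x /BS[]//].
  split => //; rewrite spanB; apply/seteqP; split.
    by apply: linear_span_sub => // x [].
  have [S0 Slin] := subspace_linear_span S.
  have SE x (lambda : K) : W x -> T x = lambda *: x -> linear_span S x.
    move=> Wx Tx; have [->|/eqP x0] := eqVneq x 0; first exact: S0.
    by apply: linear_span_incl; split => //; split => //; exists lambda.
  move=> x Wx; have WTx : W (T x) by apply: TW; exists x.
  have -> : x = 1 *: (T x) + (x - T x) by rewrite scale1r addrC subrK.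
  apply: Slin; first by apply: (SE _ 1) => //; rewrite scale1r Tid.
  have E : x - T x = (-1) *: T x + x by rewrite scaleN1r addrC.
  apply: (SE _ 0); first by rewrite E; exact: Wlin.
  by rewrite E Tlin// Tid// scaleN1r addNr scale0r.
move=> _ [x Wx <-].
have sU : subspace [set x | W x /\ W (T x)].
  split; first by split => //; rewrite T0.
  move=> a y z [Wy WTy] [Wz WTz]; split; first exact: Wlin.
  by rewrite Tlin//; exact: Wlin.
have BW : B `<=` W by rewrite -spanB; exact: linear_span_incl.
have : linear_span B x by rewrite spanB.
move=> /(linear_span_sub sU)[]// y By; split; first exact: BW.
have [_ [lambda ->]] := eigB _ By.
by have := Wlin lambda y 0 (BW _ By) W0; rewrite addr0.
Qed.

End LinearAlgebra.

(** * The network *)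

Section Network.
Context {R : realType} (G : graph).
Local Notation V := (vertex G).
Local Notation E := (edge G).

Lemma incidence_plusE (d : V -> R[i]) :
  transpose_apply (@incidence_plus R G) d = fun e => d (edge_init e).
Proof.
apply/funext => e; rewrite /transpose_apply /incidence_plus.
rewrite -(@fsbig_widen _ _ _ _ [set edge_init e] setT)//.
  by rewrite fsbig_set1 eqxx mul1r.
by move=> v [_ /= /eqP]; rewrite eq_sym => /negbTE ->; rewrite mul0r.
Qed.

Lemma incidence_minusE (d : V -> R[i]) :
  transpose_apply (@incidence_minus R G) d = fun e => d (edge_term e).
Proof.
apply/funext => e; rewrite /transpose_apply /incidence_minus.
rewrite -(@fsbig_widen _ _ _ _ [set edge_term e] setT)//.
  by rewrite fsbig_set1 eqxx mul1r.
by move=> v [_ /= /eqP]; rewrite eq_sym => /negbTE ->; rewrite mul0r.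
Qed.

Lemma tildeIE (d : V -> R[i]) :
  tildeI d = (fun e => d (edge_init e), fun e => d (edge_term e)).
Proof. by rewrite /tildeI incidence_plusE incidence_minusE. Qed.

Lemma tildeI_range_l2 x : tildeI_range R G x -> l2 R E x.1 /\ l2 R E x.2.
Proof. by move=> [d [_ [l1 l2]] <-]. Qed.

Lemma subspace_tildeI_range : subspace (tildeI_range R G).
Proof.
split.
  exists 0; last by rewrite tildeIE.
  by split; [exact: l2_0|split; rewrite tildeIE; exact: l2_0].
move=> a _ _ [d [ld [l1 l2]] <-] [d' [ld' [l1' l2']] <-].
exists (a *: d + d'); last by rewrite !tildeIE.
move: l1 l2 l1' l2'; rewrite !tildeIE /= => l1 l2 l1' l2'.
split; first exact: l2D (l2Z a ld) ld'.
by rewrite tildeIE; split; [exact: l2D (l2Z a l1) l1'|exact: l2D (l2Z a l2) l2'].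
Qed.

Lemma boundary_value_l2 (psi dpsi : E -> R -> R[i]) : L2_sum psi -> L2_sum dpsi ->
  (forall e, weak_derivative (psi e) (dpsi e)) ->
  l2 R E (boundary_value psi 0) /\ l2 R E (boundary_value psi 1).
Proof.
move=> lpsi ldpsi wpsi.
have c1 e (chi : E -> R -> R[i]) : L2_sum chi -> cintegrable (chi e).
  by move=> lchi; apply: square_integrable_cintegrable; exact: L2_sum_square.
have bv e := continuous_rep_boundary (c1 e _ lpsi) (c1 e _ ldpsi) (wpsi e).
have l0 := l2_cintegral lpsi.
have lom := l2_cintegral (L2_sumM ldpsi (@cmeasurable_onem R) (@sqmod_onem_le1 R)).
have lid := l2_cintegral (L2_sumM ldpsi (@cmeasurable_id R) (@sqmod_id_le1 R)).
split.
  have -> : boundary_value psi 0 = (fun e => cintegral (psi e)) -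
      (fun e => cintegral (fun t => (1 - t)%:C * dpsi e t)).
    by apply/funext => e; exact: (bv e).1.
  exact: (l2B l0 lom).
have -> : boundary_value psi 1 = (fun e => cintegral (psi e)) +
    (fun e => cintegral (fun t => t%:C * dpsi e t)).
  by apply/funext => e; exact: (bv e).2.
exact: (l2D l0 lid).
Qed.

Variable Y : set (E -> R[i]).
Hypothesis Ycl : l2_closed_subspace Y.

Lemma range_invariant_iff_eigenbasis :
  hatP_Y Y @` tildeI_range R G `<=` tildeI_range R G <->
  exists B : set ((E -> R[i]) * (E -> R[i])),
    algebraic_basis B (tildeI_range R G) /\ forall x, B x -> eigenvector (hatP_Y Y) x.
Proof.
apply: invariant_iff_eigenbasis.
- exact: subspace_tildeI_range.
- move=> a x y /tildeI_range_l2[x1 x2] /tildeI_range_l2[y1 y2].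
  by rewrite /hatP_Y /P_Y /= !(orth_proj_lin Ycl).
- move=> x /tildeI_range_l2[x1 x2].
  by congr (_, _); apply: (orth_proj_id Ycl); exact: (orth_proj_in Ycl).
Qed.

(** The fibrewise projection commutes with weak differentiation and with taking
    boundary values. *)
Lemma boundary_value_fibre_proj psi dpsi phi :
  L2_sum psi -> L2_sum dpsi -> (forall e, weak_derivative (psi e) (dpsi e)) ->
  L2_sum phi -> (forall e, ae01 (fun t => phi e t = fibre_proj Y psi e t)) ->
  [/\ forall e, weak_derivative (phi e) (fibre_proj Y dpsi e),
      boundary_value phi 0 = P_Y Y (boundary_value psi 0) &
      boundary_value phi 1 = P_Y Y (boundary_value psi 1)].
Proof.
move=> lpsi ldpsi wpsi lphi aephi.
have mul (u : R -> R[i]) e (C : R) : cmeasurable u ->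
    (forall t, t \in `]0, 1[ -> sqmod (u t) <= C) ->
    cintegral (fun t => u t * phi e t) =
    orth_proj l2_dot Y (fun f => cintegral (fun t => u t * psi f t)) e.
  move=> mu uC; rewrite -(cintegral_fibre_proj Ycl e lpsi mu uC).
  apply: cintegral_ae.
  - by apply: cmeasurableM => //; exact: lphi.1.
  - by apply: cmeasurableM => //; exact: cmeasurable_fibre_proj.
  - by apply: ae01S (aephi e) => t _ ->.
have lQ := L2_sum_fibre_proj Ycl ldpsi.
have l2mul (u : R -> R[i]) (C : R) chi : cmeasurable u ->
    (forall t, t \in `]0, 1[ -> sqmod (u t) <= C) -> L2_sum chi ->
    l2 R E (fun f => cintegral (fun t => u t * chi f t)).
  by move=> mu uC lchi; apply: l2_cintegral; exact: L2_sumM uC.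
have wphi e : weak_derivative (phi e) (fibre_proj Y dpsi e).
  move=> h th; have [dh ch _] := th.
  have conth : continuous h.
    by move=> t; apply: differentiable_continuous; exact/derivable1_diffP.
  have bdd (k : R -> R) : continuous k -> cmeasurable (fun t => (k t)%:C) /\
      exists C, forall t, t \in `]0, 1[ -> sqmod (k t)%:C <= C.
    move=> ck; split.
      by apply: cmeasurableC; apply: measurable_funTS; exact: continuous_measurable_fun.
    have ck2 : {within `[0, 1], continuous (fun t => k t * k t)}.
      by apply: continuous_subspaceT => t; apply: cvgM; exact: ck.
    have [c _ cmax] := EVT_max ler01 ck2.
    exists (k c * k c) => t; rewrite in_itv/= => /andP[t0 t1]; rewrite sqmodC expr2.
    by apply: cmax; rewrite in_itv/= !ltW.
  have [mh [C hC]] := bdd _ conth; have [mh' [C' hC']] := bdd _ ch.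
  have comm (f g : R -> R[i]) : cintegral (fun t => f t * g t) = cintegral (fun t => g t * f t).
    by apply: eq_cintegral => t _; rewrite mulrC.
  rewrite (comm (phi e)) (comm (fibre_proj Y dpsi e)) (mul _ _ _ mh' hC') (cintegral_fibre_proj Ycl e ldpsi mh hC).
  rewrite -[RHS]/((- _ : E -> R[i]) e) -(orth_projN Ycl); last exact: (l2mul _ _ _ mh hC).
  congr (orth_proj _ _ _ e); apply/funext => f.
  by rewrite -(comm (psi f)) (wpsi f _ th) (comm (dpsi f)).
have c1 e (chi : E -> R -> R[i]) : L2_sum chi -> cintegrable (chi e).
  by move=> lchi; apply: square_integrable_cintegrable; exact: L2_sum_square.
have m1 := @cmeasurable_cst R 1.
have b1 (t : R) : t \in `]0, 1[ -> sqmod (1 : R[i]) <= 1.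
  by rewrite /sqmod/= expr1n expr0n/= addr0.
have one (f : R -> R[i]) : cintegral f = cintegral (fun t => 1 * f t).
  by apply: eq_cintegral => t _; rewrite mul1r.
have l1 := l2mul _ _ _ m1 b1 lpsi.
have lom := l2mul _ _ _ (@cmeasurable_onem R) (@sqmod_onem_le1 R) ldpsi.
have lid := l2mul _ _ _ (@cmeasurable_id R) (@sqmod_id_le1 R) ldpsi.
split=> //; apply/funext => e.
- rewrite /boundary_value.
  have [-> _] := continuous_rep_boundary (c1 e _ lphi) (c1 e _ lQ) (wphi e).
  rewrite one (mul _ _ _ m1 b1) (cintegral_fibre_proj Ycl e ldpsi (@cmeasurable_onem R) (@sqmod_onem_le1 R)).
  rewrite -[LHS]/((_ - _ : E -> R[i]) e) -(orth_projB Ycl)//.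
  congr (orth_proj _ _ _ e); apply/funext => f.
  have [-> _] := continuous_rep_boundary (c1 f _ lpsi) (c1 f _ ldpsi) (wpsi f).
  by rewrite (one (psi f)).
- rewrite /boundary_value.
  have [_ ->] := continuous_rep_boundary (c1 e _ lphi) (c1 e _ lQ) (wphi e).
  rewrite one (mul _ _ _ m1 b1) (cintegral_fibre_proj Ycl e ldpsi (@cmeasurable_id R) (@sqmod_id_le1 R)).
  rewrite -[LHS]/((_ + _ : E -> R[i]) e) -(orth_projD Ycl)//.
  congr (orth_proj _ _ _ e); apply/funext => f.
  have [_ ->] := continuous_rep_boundary (c1 f _ lpsi) (c1 f _ ldpsi) (wpsi f).
  by rewrite (one (psi f)).
Qed.

(** From left to right, a vector in the range is the pair of boundary values of a
    family of affine functions in the form domain, whose projection is again a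
    family of affine functions, with projected boundary values. From right to
    left, the boundary values of a function in the form domain lie in the range,
    and the projection acts on them by the projection onto [Y]. *)
Lemma admissible_iff_range_invariant :
  P_calY Y @` network_form_domain R G `<=` network_form_domain R G <->
  hatP_Y Y @` tildeI_range R G `<=` tildeI_range R G.
Proof.
split=> [admY|invY].
- move=> _ [_ [d [ld ldE] <-] <-]; move: ldE; rewrite tildeIE /= => -[la lb].
  set a := (fun e => _) in la *; set b := (fun e => _) in lb *.
  pose psi e := affine (a e) (b e).
  have lpsi : L2_sum psi by exact: L2_sum_affine.
  have dom_psi : network_form_domain R G psi.
    split.
      split => //; exists (fun e (_ : R) => b e - a e).
        by apply: L2_sum_cst; exact: (l2B lb la).
      by move=> e; exact: weak_derivative_affine.
    have bd e := @continuous_rep_affine R (psi e) (a e) (b e) (ae01_all (fun _ _ => erefl)).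
    exists d; split => //; apply/funext => e.
      by rewrite incidence_plusE /boundary_value (bd e).1.
    by rewrite incidence_minusE /boundary_value (bd e).2.
  have [_ [d' [ld' d0 d1]]] := admY _ (ex_intro2 _ _ psi dom_psi erefl).
  have [YP aeP] := orth_proj_calY Ycl lpsi.
  have bdP e : continuous_rep (P_calY Y psi e) 0 = P_Y Y a e /\
      continuous_rep (P_calY Y psi e) 1 = P_Y Y b e.
    apply: continuous_rep_affine; apply: ae01S (aeP e) => t _ et.
    have lt : l2 R E (psi^~ t).
      exact: l2D (l2Z (1 - t)%:C la) (l2Z t%:C lb).
    rewrite /P_calY et -[LHS]/(((fibre_proj Y psi)^~ t) e) (fibre_projE Ycl lt).
    have -> : psi^~ t = (1 - t)%:C *: a + t%:C *: b by [].
    by rewrite (orth_projD Ycl (l2Z _ la) (l2Z _ lb)) !(orth_projZ Ycl).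
  have E0 : transpose_apply (@incidence_plus R G) d' = P_Y Y a.
    by rewrite d0; apply/funext => e; rewrite /boundary_value (bdP e).1.
  have E1 : transpose_apply (@incidence_minus R G) d' = P_Y Y b.
    by rewrite d1; apply/funext => e; rewrite /boundary_value (bdP e).2.
  exists d'; last by rewrite /tildeI E0 E1.
  by split => //; rewrite /tildeI E0 E1; split; exact: (l2_orth_proj Ycl).
- move=> _ [psi [[lpsi [dpsi ldpsi wpsi]] [d [ld d0 d1]]] <-].
  have [[lP YP] aeP] := orth_proj_calY Ycl lpsi.
  have [wP b0 b1] := boundary_value_fibre_proj lpsi ldpsi wpsi lP aeP.
  split.
    by split; [exact: lP|exists (fibre_proj Y dpsi); [exact: L2_sum_fibre_proj|exact: wP]].
  have [l0 l1] := boundary_value_l2 lpsi ldpsi wpsi.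
  have [d' [ld' _] Ed'] : tildeI_range R G (hatP_Y Y (tildeI d)).
    apply: invY; exists (tildeI d) => //; exists d => //; split => //.
    by rewrite /tildeI d0 d1.
  exists d'; split => //.
    by rewrite -[LHS]/(tildeI d').1 Ed' /= d0 -b0.
  by rewrite -[LHS]/(tildeI d').2 Ed' /= d1 -b1.
Qed.

End Network.

Theorem theorem66 (R : realType) (G : graph) (Y : set (edge G -> R[i])) :
  connected_graph G ->
  l2_closed_subspace Y ->
  let a := P_calY Y @` network_form_domain R G `<=` network_form_domain R G in
  let b := hatP_Y Y @` tildeI_range R G `<=` tildeI_range R G in
  let c := exists B : set ((edge G -> R[i]) * (edge G -> R[i])),
    algebraic_basis B (tildeI_range R G) /\
    forall x, B x -> eigenvector (hatP_Y Y) x in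
  (a <-> b) /\ (b <-> c).
Proof.
move=> _ Ycl a b c.
by split; [exact: admissible_iff_range_invariant|exact: range_invariant_iff_eigenbasis].
Qed.
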